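(* For all $p\in\mathbb{N}$, $H\in(1/4,1/2)\cup(1/2,1)$ and $\alpha\in(0,2H-1/2)$, there exists $C_{p,H,\alpha}\in(0,\infty)$ such that one has \[ \mathbb{E}[\|Z^H(t_2)-Z^H(t_1)\|^{2p}]\le C_{p,H,\alpha}|t_2-t_1|^{p\alpha},\qquad \forall~t_2\ge t_1\ge 0. \]
   Context: $\mathbb{N}=\{1,2,\ldots\}$. $\mathbb{H}=L^2((0,1);\mathbb{R})$ with norm $\|\cdot\|$. For $k\in\mathbb{N}$, $\lambda_k=k^2\pi^2$, $e_k=\sqrt2\sin(k\pi\cdot)$ (eigenpairs of $Ax=-x''$ on $(0,1)$ with homogeneous Dirichlet boundary conditions). $S(t)x=\sum_ke^{-\lambda_kt}\langle x,e_k\rangle e_k$. $(\beta_k^H)_{k\in\mathbb{N}}$ are independent real-valued fractional Brownian motions with Hurst index $H$ (centered Gaussian, continuous paths, covariance $\frac12(t^{2H}+s^{2H}-|t-s|^{2H})$), and $B^H(t)=\sum_k\beta_k^H(t)e_k$ (formal series). For $\phi\in\mathcal{C}^1([0,t])$, $\int_0^t\phi(s)\,d\beta_k^H(s)=\phi(t)\beta_k^H(t)-\int_0^t\phi'(s)\beta_k^H(s)\,ds$. The fractional Ornstein–Uhlenbeck process is \[ Z^H(t)=\int_0^tS(t-s)\,dB^H(s)=\sum_{k\in\mathbb{N}}\mathcal{Z}_k^H(t)e_k,\qquad \mathcal{Z}_k^H(t)=\int_0^te^{-\lambda_k(t-s)}\,d\beta_k^H(s). \] *)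

(* Defs.v *)
From mathcomp Require Import all_boot all_order all_algebra.
From mathcomp Require Import finmap.
From mathcomp Require Import all_classical all_reals all_analysis.
From mathcomp Require Import measurable_realfun.

Set Implicit Arguments.
Unset Strict Implicit.
Unset Printing Implicit Defensive.

Import Order.TTheory GRing.Theory Num.Theory.
Import numFieldNormedType.Exports.

Local Open Scope classical_set_scope.
Local Open Scope ring_scope.

Section L2.
Variable R : realType.

Let mI : measurable (`]0, 1[%classic : set (measurableTypeR R)).
Proof. exact: measurable_itv. Qed.

Definition lebesgue01 : {measure set (measurableTypeR R) -> \bar R} :=
  mrestr lebesgue_measure mI.

(* L^2((0,1); R).  Elements are measurable representatives defined on all of R;
   the norm only sees their restriction to (0,1), up to null sets. *)
Definition L2unit := LfunType lebesgue01 (lee1n 2).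

(* [fine] is harmless: the Lnorm of an element of [L2unit] is finite. *)
Definition L2norm (f : L2unit) : R :=
  fine ('N[lebesgue01]_(2%:R%:E)[EFin \o f])%E.

(* Indices are shifted: index k : nat stands for the eigenpair
   (lambda_{k+1}, e_{k+1}). *)
Definition eigenval (k : nat) : R := k.+1%:R ^+ 2 * pi ^+ 2.

Definition eigenfun_fun (k : nat) (x : R) : R :=
  Num.sqrt 2 * sin (k.+1%:R * pi * x).

Lemma measurable_eigenfun_fun k : measurable_fun setT (eigenfun_fun k).
Proof.
apply: continuous_measurable_fun => x.
apply: cvgM; first exact: cvg_cst.
apply: (continuous_comp (f := fun x => k.+1%:R * pi * x) (g := sin)).
  by apply: cvgM; [exact: cvg_cst|exact: cvg_id].
exact: continuous_sin.
Qed.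

Lemma lebesgue01_setT : lebesgue01 setT = 1%E.
Proof.
rewrite /lebesgue01/= /mrestr setTI.
have := lebesgue_measure_itv (`]0%R, 1%R[ : interval R).
by rewrite /= lte_fin ltr01 sube0.
Qed.

Lemma eigenfun_fun_Lfun k : eigenfun_fun k \in Lfun lebesgue01 2%:R%:E.
Proof.
have fin : finite_norm lebesgue01 2%:R%:E (eigenfun_fun k).
  rewrite /finite_norm unlock poweR_lty//.
  apply: (@le_lt_trans _ _ (\int[lebesgue01]_(x in setT)
      (cst (Num.sqrt 2 `^ 2)%:E x))%E); last first.
    by rewrite integral_cst// lebesgue01_setT mule1 ltry.
  apply: ge0_le_integral => //.
  - by move=> x _; exact: poweR_ge0.
  - apply/measurable_EFinP.
    apply: (measurableT_comp (measurable_powR _)) => //.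
    by apply: measurableT_comp => //; exact: measurable_eigenfun_fun.
  - move=> x _; rewrite /= lee_fin ge0_ler_powR ?nnegrE//.
    rewrite normrM ger0_norm ?sqrtr_ge0// ler_piMr ?sqrtr_ge0//.
    by rewrite ler_norml sin_geN1 sin_le1.
apply/andP; split; rewrite inE /=; last exact: fin.
exact: measurable_eigenfun_fun.
Qed.

Definition eigenfun (k : nat) : L2unit := Lfun_Sub (lee1n 2) (eigenfun_fun_Lfun k).

(* int_0^t phi(s) db(s), defined pathwise by integration by parts for a C^1
   integrand phi and a continuous b with b(0) = 0. *)
Definition wiener_int (phi b : R -> R) (t : R) : R :=
  phi t * b t - \int[lebesgue_measure]_(s in `[0, t]) (derive1 phi s * b s).

End L2.

Section Processes.
Context d (T : measurableType d) (R : realType) (P : probability T R).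

(* Processes are indexed by R, but only nonnegative times matter. *)
Implicit Types (X : R -> T -> R) (beta : nat -> R -> T -> R).

(* The degenerate case s = 0 is the Dirac mass at m; it is separated because
   [normal_prob m 0] is not a Dirac mass in the library. *)
Definition gaussian (Y : T -> R) : Prop :=
  measurable_fun setT Y /\
  exists m s : R, forall A : set R, measurable A ->
    P (Y @^-1` A) = if s == 0 then (\d_m A)%E else normal_prob m s A.

Definition gaussian_process X : Prop :=
  forall (n : nat) (a t : 'I_n -> R), (forall i, 0 <= t i) ->
    gaussian (fun w => \sum_(i < n) a i * X (t i) w).

Definition is_fBm (H : R) X : Prop :=
  [/\ gaussian_process X,
      forall t, 0 <= t -> ('E_P[X t] = 0)%E,
      forall s t, 0 <= s -> 0 <= t -> covariance P (X s) (X t) =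
        (2^-1 * (t `^ (2 * H) + s `^ (2 * H) - `|t - s| `^ (2 * H)))%:E &
      forall w, {within `[0, +oo[, continuous (fun t => X t w)}].

Definition sigma_process X : set (set T) :=
  <<s \bigcup_(t in `[0, +oo[) preimage_set_system setT (X t) measurable >>.

Definition independent_processes beta : Prop :=
  forall (J : {fset nat}) (E : nat -> set T),
    (forall k, k \in J -> sigma_process (beta k) (E k)) ->
    P (\bigcap_(k in [set` J]) E k) = (\prod_(k <- J) P (E k))%E.

Definition fOU_coef beta (k : nat) (t : R) (w : T) : R :=
  wiener_int (fun s => expR (- (eigenval R k * (t - s)))) (fun s => beta k s w) t.

Definition fOU_partial beta (t : R) (w : T) (n : nat) : L2unit R :=
  \sum_(k < n) fOU_coef beta k t w *: eigenfun R k.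

(* Z^H(t)(w) is the sum in L^2(0,1) of the series of the Z_k(t)(w) e_k.  As with
   the library's [lim], the value at a w where the series diverges is a default
   one. *)
Definition fOU beta (t : R) (w : T) : L2unit R :=
  xget 0 [set z : L2unit R |
    (fun n => L2norm (fOU_partial beta t w n - z)) @ \oo --> (0 : R)].

End Processes.

(* Main.v *)
Require Import Defs.
From mathcomp Require Import all_boot all_order all_algebra.
From mathcomp Require Import all_classical all_reals all_analysis.
From mathcomp Require Import measurable_realfun ring lra.

(** Write b for the k-th fractional Brownian motion, lam for lambda_k and
    Z_k(t) for the k-th coordinate.  After the integration by parts which
    defines Z_k, the equation dZ_k = - lam Z_k dt + db takes the pathwise form

      Z_k(t2) - Z_k(t1) = (exp(-lam (t2-t1)) - 1) Z_k(t1) + I(t1, t2, b(t1)),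
      Z_k(t) = I(0, t, 0),
      I(a, t, y) = exp(-lam (t-a)) (b(t) - y)
                   + int_a^t lam exp(-lam (t-s)) (b(t) - b(s)) ds

    ([ou_intB], [ou_int_incr0]).  The weights in I(a, t, y) form a probability,
    so I is an average of increments of b and Jensen's inequality bounds
    I^(2p) by the same average of their (2p)-th powers
    ([ou_incr_le_majorant]).  These increments are Gaussian with variance
    |t-s|^(2H), hence have (2p)-th moment at most C |t-s|^(2Hp)
    ([is_fBm_moment_le]).  After Tonelli's theorem, part of the power
    |t-s|^(2Hp) is bounded by the length of the interval and the other part is
    absorbed by the exponential, which turns it into a power of 1/lam
    ([ou_majorant_moment_le]); the result is

      E |Z_k(t2) - Z_k(t1)|^(2p) <= C |t2-t1|^(p alpha) lam^(-p (2H-alpha))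

    ([ou_incr_majorant_moment_le]), with a constant free of k, t1 and t2.

    The coordinates are summed by means of the weights
    w_k = lambda_k^(-(2H-alpha)), which are summable because
    2 (2H-alpha) > 1.  By convexity (sum_k x_k)^p is at most
    (sum_k w_k)^(p-1) sum_k w_k^(1-p) x_k^p; with x_k = |Z_k(t2) - Z_k(t1)|^2
    the expectation of the right-hand side is at most
    C (sum_k w_k)^p |t2-t1|^(p alpha).

    Finally, the squared norm of the increment is the sum of the x_k wherever
    the two series converge in L^2: the sines are orthonormal
    ([L2norm_eigen_sum]) and L^2 is complete ([L2unit_complete]).  The series
    at time t converges wherever an integrable function of the same kind as
    above is finite, and [le_integral_finite_guard] discards the remaining
    null set, on which the process takes a default value. *)

Set Implicit Arguments.
Unset Strict Implicit.
Unset Printing Implicit Defensive.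

Import Order.TTheory GRing.Theory Num.Theory.
Import numFieldNormedType.Exports.

Local Open Scope classical_set_scope.
Local Open Scope ring_scope.

(** * Elementary inequalities *)

Section elementary.
Variable R : realType.
Implicit Types (x y m q : R).

(** The graph of a power lies above its tangent at m.  When m is the mean of x
    and the inequality is averaged, this is Jensen's inequality; it is used in
    this way for finite sums and for integrals. *)
Lemma exprS_tangent n x m : 0 <= x -> 0 <= m ->
  m ^+ n.+1 + n.+1%:R * m ^+ n * (x - m) <= x ^+ n.+1.
Proof.
move=> x0 m0; elim: n => [|n IH]; first by rewrite !expr1 expr0 !mul1r; lra.
rewrite [leRHS]exprS; apply: le_trans (ler_wpM2l x0 IH).
rewrite -subr_ge0.
have -> : x * (m ^+ n.+1 + n.+1%:R * m ^+ n * (x - m)) -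
   (m ^+ n.+2 + n.+2%:R * m ^+ n.+1 * (x - m)) =
   n.+1%:R * m ^+ n * (x - m) ^+ 2.
  by rewrite !exprS -[n.+2%:R]natr1; ring.
by rewrite mulr_ge0// ?sqr_ge0// mulr_ge0// exprn_ge0.
Qed.

(** Jensen's inequality for the probability with masses proportional to w k
    and the values x k / w k. *)
Lemma exprS_sum_le_weighted (n q : nat) (x w : nat -> R) :
  (forall k, 0 <= x k) -> (forall k, 0 < w k) ->
  (\sum_(k < n) x k) ^+ q.+1 <=
  (\sum_(k < n) w k) ^+ q * \sum_(k < n) x k ^+ q.+1 / w k ^+ q.
Proof.
move=> x0 w0; case: n => [|n].
  by rewrite !big_ord0 mulr0 exprS mul0r.
set W := \sum_(k < _) w k; set X := \sum_(k < _) x k.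
have W0 : 0 < W.
  rewrite /W big_ord_recl ltr_wpDr//.
  by apply: sumr_ge0 => i _; exact: ltW.
have X0 : 0 <= X by exact: sumr_ge0.
pose m := X / W.
have m0 : 0 <= m by rewrite divr_ge0// ltW.
have key : W * m ^+ q.+1 <= \sum_(k < n.+1) x k ^+ q.+1 / w k ^+ q.
  have -> : W * m ^+ q.+1 = \sum_(k < n.+1)
      (w k * m ^+ q.+1 + q.+1%:R * m ^+ q * (x k - m * w k)).
    rewrite big_split/= -mulr_suml -mulr_sumr sumrB -mulr_sumr -/X -/W.
    by rewrite divfK ?gt_eqF// subrr mulr0 addr0.
  apply: ler_sum => k _.
  have xw0 : 0 <= x k / w k by rewrite divr_ge0// ltW.
  have := ler_wpM2l (ltW (w0 k)) (exprS_tangent q xw0 m0).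
  have wn0 : w k != 0 by rewrite gt_eqF.
  rewrite mulrDr mulrCA mulrBr mulrC.
  congr (_ <= _).
    by rewrite [_ ^+ _ * _]mulrC; congr (_ + _); field.
  by rewrite expr_div_n [w k ^+ q.+1]exprS; field; rewrite expf_neq0.
apply: le_trans (ler_wpM2l (exprn_ge0 q (ltW W0)) key).
by rewrite mulrA -exprSr /m expr_div_n mulrC divfK// expf_neq0// gt_eqF.
Qed.

(** Lets an exponential absorb a power of its argument at the cost of half of
    its rate. *)
Lemma powR_le_expR q : 0 <= q ->
  exists2 C, 0 < C & forall x, 0 <= x -> x `^ q <= C * expR (x / 2).
Proof.
move=> q0; pose n := Num.truncn q.
have qn : q <= n.+1%:R by exact: ltW (truncnS_gt _).
exists (1 + 2 ^+ n.+1 * n.+1`!%:R).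
  by rewrite ltr_pwDl// mulr_ge0// exprn_ge0.
move=> x x0.
have xn : x `^ q <= 1 + x ^+ n.+1.
  have [x1|x1] := leP x 1.
    have [->|q0'] := eqVneq q 0; first by rewrite powRr0 lerDl exprn_ge0.
    apply: (@le_trans _ _ 1); last by rewrite lerDl exprn_ge0.
    have -> : 1 = 1 `^ q :> R by rewrite powR1.
    by rewrite ge0_ler_powR// nnegrE.
  rewrite -powR_mulrn//; apply: (@le_trans _ _ (x `^ n.+1%:R)).
    by rewrite ler_powR// ltW.
  by rewrite lerDr.
apply: (le_trans xn); rewrite mulrDl mul1r lerD//.
  by rewrite -[leLHS]expR0 ler_expR divr_ge0.
have y0 : 0 <= x / 2 by rewrite divr_ge0.
have := expR_ge1Dxn n y0.
have f0 : 0 < n.+1`!%:R :> R by rewrite ltr0n fact_gt0.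
move=> h; have {h} : (x / 2) ^+ n.+1 / n.+1`!%:R <= expR (x / 2).
  by apply: le_trans h; rewrite lerDr.
rewrite ler_pdivrMr// => h.
have -> : x ^+ n.+1 = 2 ^+ n.+1 * (x / 2) ^+ n.+1.
  by rewrite -exprMn; congr (_ ^+ _); field.
rewrite -mulrA; apply: ler_wpM2l; first exact: exprn_ge0.
by rewrite [leRHS]mulrC.
Qed.

End elementary.

Section real_powers.
Context {R : realType}.
Implicit Types x s d : R.

(** Interpolation between the bounds x ^+ n, good for small x, and 1. *)
Lemma sub1expRN_exprn_le (n : nat) x s : 0 <= x -> 0 <= s <= n%:R ->
  (1 - expR (- x)) ^+ n <= x `^ s.
Proof.
move=> x0 /andP[s0 sn].
have y0 : 0 <= 1 - expR (- x) by rewrite subr_ge0 -expR0 ler_expR oppr_le0.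
have [x1|x1] := leP x 1; last first.
  apply: (@le_trans _ _ 1).
    by rewrite exprn_ile1// lerBlDr lerDl expR_ge0.
  by rewrite -(powRr0 x) ler_powR// ltW.
apply: (@le_trans _ _ (x ^+ n)).
  rewrite lerXn2r ?nnegrE// lerBlDr.
  by have := expR_ge1Dx (- x); lra.
rewrite -powR_mulrn//; move: x0; rewrite le_eqVlt => /predU1P[<-|x0].
  have [->|s0'] := eqVneq s 0; last first.
    rewrite !powR0//; apply/eqP => n0; move: sn; rewrite n0 => sn.
    by move/eqP: s0'; apply; apply/eqP; rewrite eq_le s0 sn.
  by rewrite powRr0 powR_mulrn// exprn_ile1.
by rewrite /powR gt_eqF// ler_expR ler_wnM2r// ln_le0.
Qed.

(** A telescoping comparison: with r = (n+1) / (n+2), the inequality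
    (n+1)^(-d) - (n+2)^(-d) >= d (n+2)^(-(1+d)) amounts to
    r^(-d) >= 1 + d / (n+2), which follows from exp u >= 1 + u at
    u = - d ln r and from ln r <= r - 1 = - 1 / (n+2). *)
Lemma sum_powRN_le d (n : nat) : 0 < d ->
  \sum_(k < n) k.+1%:R `^ (- (1 + d)) <= 1 + d^-1.
Proof.
move=> d0.
case: n => [|n]; first by rewrite big_ord0 addr_ge0// invr_ge0 ltW.
apply: (@le_trans _ _ (1 + d^-1 * (1 - n.+1%:R `^ (- d)))); last first.
  by rewrite lerD2l ler_piMr ?invr_ge0 ?(ltW d0)// lerBlDr lerDl powR_ge0.
elim: n => [|n IH]; first by rewrite big_ord1 !powR1 subrr mulr0 addr0.
rewrite big_ord_recr/=; apply: le_trans (lerD IH (lexx _)) _.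
rewrite -addrA lerD2l -lerBrDl -mulrBr.
have -> : 1 - n.+2%:R `^ (- d) - (1 - n.+1%:R `^ (- d)) =
  n.+1%:R `^ (- d) - n.+2%:R `^ (- d) by ring.
rewrite ler_pdivlMl//.
have n1 : (0 : R) < n.+1%:R by rewrite ltr0n.
have n2 : (0 : R) < n.+2%:R by rewrite ltr0n.
have -> : n.+2%:R `^ (- (1 + d)) = n.+2%:R^-1 * n.+2%:R `^ (- d).
  rewrite opprD powRD; last by rewrite (gt_eqF n2) implybT.
  by rewrite powR_inv1.
rewrite lerBrDr.
rewrite -[X in _ + X]mul1r mulrA -mulrDl.
have -> : n.+1%:R `^ (- d) = (n.+1%:R / n.+2%:R) `^ (- d) * n.+2%:R `^ (- d).
  by rewrite -powRM ?divr_ge0// divfK// gt_eqF.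
rewrite ler_wpM2r ?powR_ge0//.
rewrite /powR gt_eqF ?divr_gt0//.
apply: le_trans (expR_ge1Dx _); rewrite addrC lerD2l mulNr -mulrN.
rewrite ler_wpM2l ?(ltW d0)// lerNr.
have -> : n.+1%:R / n.+2%:R = 1 + - n.+2%:R^-1 :> R.
  have -> : n.+1%:R = n.+2%:R - 1 :> R by rewrite -[n.+2%:R]natr1 addrK.
  by rewrite mulrBl divff ?gt_eqF// mul1r.
apply: le_ln1Dx.
by rewrite ltrNl opprK invf_lt1// ltr1n.
Qed.

End real_powers.

(** * Moments of Gaussian variables and of fractional Brownian motion *)

Section density.
Context {R : realType}.
Local Open Scope ereal_scope.
Let mu := @lebesgue_measure R.

(** The density of a normal law agrees almost everywhere with the
    Radon-Nikodym derivative, because both have the same integral over every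
    measurable set. *)
Lemma integral_normal_probE (m s : R) (f : _ -> \bar R) :
  measurable_fun setT f -> (forall x, 0 <= f x) ->
  \int[normal_prob m s]_x f x = \int[mu]_x (f x * (normal_pdf m s x)%:E).
Proof.
move=> mf f0; have dom := normal_prob_dominates m s.
rewrite -(Radon_Nikodym_SigmaFinite.change_of_variables dom)//.
apply: ae_eq_integral => //.
- apply: emeasurable_funM => //.
  exact: measurable_int (Radon_Nikodym_SigmaFinite.f_integrable dom).
- apply: emeasurable_funM => //.
  by apply/measurable_EFinP; exact: measurable_normal_pdf.
- apply: ae_eqe_mul2l.
  apply: integral_ae_eq => //.
  + exact: Radon_Nikodym_SigmaFinite.f_integrable.
  + by apply/measurable_EFinP; exact: measurable_normal_pdf.
  + by move=> E _ mE; rewrite -Radon_Nikodym_SigmaFinite.f_integral.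
Qed.

End density.

Section gaussian_moments.
Context {R : realType}.
Local Open Scope ereal_scope.
Let mu := @lebesgue_measure R.

(** With u = ((x-m)/s)^2, half of the Gaussian exponent absorbs u^n:
    u^n exp(-u/2) <= C exp(-u/4).  What remains is a multiple of the normal
    density with standard deviation sqrt 2 * s, whose mass is 1. *)
Lemma normal_central_moment_le (n : nat) :
  exists2 C : R, (0 < C)%R & forall m s : R, s != 0%R ->
  \int[normal_prob m s]_x ((x - m) ^+ (2 * n))%:E <= (C * s ^+ (2 * n))%:E.
Proof.
have [C C0 hC] := @powR_le_expR R n%:R (ler0n _ _).
exists (C * 2 ^+ n * Num.sqrt 2)%R; first by rewrite !mulr_gt0 ?exprn_gt0 ?sqrtr_gt0.
move=> m s s0.
have ms : measurable_fun setT (fun x : measurableTypeR R => ((x - m) ^+ (2 * n))%:E).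
  apply/measurable_EFinP; apply: measurable_funX; exact: measurable_funB.
rewrite integral_normal_probE//; last first.
  by move=> x; rewrite lee_fin exprM exprn_ge0// sqr_ge0.
have s2n0 : (0 <= s ^+ (2 * n))%R by rewrite exprM exprn_ge0// sqr_ge0.
pose s' := (Num.sqrt 2 * s)%R.
have s'0 : s' != 0%R by rewrite mulf_neq0// gt_eqF// sqrtr_gt0.
apply: (@le_trans _ _ (\int[mu]_x ((C * 2 ^+ n * Num.sqrt 2 * s ^+ (2 * n))%:E *
   (normal_pdf m s' x)%:E))).
  apply: ge0_le_integral => //.
  - by move=> x _; rewrite -EFinM lee_fin mulr_ge0 ?normal_pdf_ge0// exprM exprn_ge0// sqr_ge0.
  - apply: emeasurable_funM => //.
    by apply/measurable_EFinP; exact: measurable_normal_pdf.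
  - apply: emeasurable_funM => //.
    by apply/measurable_EFinP; exact: measurable_normal_pdf.
  move=> x _; rewrite -!EFinM lee_fin !normal_pdfE//.
  have peakE : normal_peak s = (Num.sqrt 2 * normal_peak s')%R.
    rewrite /normal_peak /s' exprMn sqr_sqrtr//.
    rewrite -[(2 * s ^+ 2 * pi)%R]mulrA -[in RHS]mulrnAr [in RHS]sqrtrM//.
    by rewrite invfM mulrA divff ?mul1r// gt_eqF// sqrtr_gt0.
  pose u := ((x - m) ^+ 2 / s ^+ 2)%R.
  have u0 : (0 <= u)%R by rewrite divr_ge0 ?sqr_ge0.
  have uE : ((x - m) ^+ (2 * n) = s ^+ (2 * n) * u ^+ n)%R.
    by rewrite !exprM -exprMn /u mulrC divfK// expf_neq0.
  have funE : normal_fun m s x = expR (- u / 2).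
    by rewrite /normal_fun /u; congr expR; field.
  have funE' : normal_fun m s' x = expR (- u / 2 / 2).
    rewrite /normal_fun /u /s' exprMn sqr_sqrtr//.
    by congr expR; field.
  rewrite peakE funE funE' uE.
  have un : (u ^+ n <= 2 ^+ n * (C * expR (u / 2 / 2)))%R.
    have u20 : (0 <= u / 2)%R by rewrite divr_ge0.
    have := hC _ u20; rewrite powR_mulrn// => h.
    rewrite [u in leLHS](_ : u = 2 * (u / 2))%R; last by field.
    by rewrite exprMn; apply: ler_wpM2l => //; exact: exprn_ge0.
  have -> : expR (- u / 2) = (expR (- u / 2 / 2) / expR (u / 2 / 2))%R.
    by rewrite -expRN -expRD; congr expR; field.
  set e := expR (- u / 2 / 2); set e' := expR (u / 2 / 2).
  have e'0 : (0 < e')%R by exact: expR_gt0.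
  have -> : (s ^+ (2 * n) * u ^+ n * (Num.sqrt 2 * normal_peak s' * (e / e')) =
    (s ^+ (2 * n) * Num.sqrt 2 * normal_peak s' * e / e') * u ^+ n)%R by ring.
  have -> : (C * 2 ^+ n * Num.sqrt 2 * s ^+ (2 * n) * (normal_peak s' * e) =
    (s ^+ (2 * n) * Num.sqrt 2 * normal_peak s' * e / e') * (2 ^+ n * (C * e')))%R.
    by field; rewrite gt_eqF.
  apply: ler_wpM2l un; rewrite divr_ge0 ?(ltW e'0)// mulr_ge0 ?expR_ge0//.
  by rewrite mulr_ge0 ?normal_peak_ge0// mulr_ge0.
rewrite ge0_integralZl//=.
- by rewrite integral_normal_pdf mule1.
- by apply/measurable_EFinP; exact: measurable_normal_pdf.
- by move=> x _; rewrite lee_fin normal_pdf_ge0.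
- by rewrite lee_fin mulr_ge0// !mulr_ge0 ?exprn_ge0// ltW.
Qed.

(** The interval has length |s| and the density is at most
    1 / (|s| sqrt (2 pi)), wherever the mean m lies. *)
Lemma normal_prob_near0_le (m s : R) : s != 0%R ->
  normal_prob m s `[(- (`|s| / 2))%R, (`|s| / 2)%R]%classic <= (2^-1)%:E.
Proof.
move=> s0; have s0' : (0 < `|s|)%R by rewrite normr_gt0.
rewrite /normal_prob.
apply: (@le_trans _ _ (\int[mu]_(x in `[(- (`|s| / 2))%R, (`|s| / 2)%R]%classic)
    (normal_peak s)%:E)).
  apply: ge0_le_integral => //.
  - by move=> x _; rewrite lee_fin normal_pdf_ge0.
  - apply/measurable_EFinP/measurable_funTS; exact: measurable_normal_pdf.
  - by move=> x _; rewrite lee_fin normal_pdf_ub.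
rewrite integral_cst//= lebesgue_measure_itv/= lte_fin.
rewrite ifT; last by lra.
rewrite -EFinD -EFinM lee_fin opprK -splitr /normal_peak.
rewrite ler_pdivrMl; last first.
  by rewrite sqrtr_gt0 mulrn_wgt0// mulr_gt0 ?pi_gt0// exprn_even_gt0.
rewrite ler_pdivlMr// -[leLHS]ger0_norm ?mulr_ge0// -sqrtr_sqr.
rewrite ler_wsqrtr// exprMn real_normK ?num_real// -mulr_natr.
have := ler_wpM2l (sqr_ge0 s) (pi_ge2 R); lra.
Qed.

(** At least half of the mass lies where x^2 >= s^2/4, by
    [normal_prob_near0_le]; this controls s by a moment about 0 instead of
    about the mean. *)
Lemma normal_var_le (m s : R) : s != 0%R ->
  (s ^+ 2 / 8)%:E <= \int[normal_prob m s]_x (x ^+ 2)%:E.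
Proof.
move=> s0; have s0' : (0 < `|s|)%R by rewrite normr_gt0.
set J := `[(- (`|s| / 2))%R, (`|s| / 2)%R]%classic.
have mJ : measurable (J : set (measurableTypeR R)) by exact: measurable_itv.
have mJC : measurable (~` J : set (measurableTypeR R)) by exact: measurableC.
apply: (@le_trans _ _ (\int[normal_prob m s]_x
    ((s ^+ 2 / 4)%:E * (\1_(~` J) x)%:E))).
  rewrite ge0_integralZl//=; last 2 first.
  - by apply/measurable_EFinP; exact: measurable_indic.
  - by rewrite lee_fin divr_ge0// sqr_ge0.
  rewrite integral_indic// setIT.
  rewrite [X in _ * X](_ : _ = 1 - normal_prob m s J); last exact: probability_setC.
  have := normal_prob_near0_le m s0; rewrite -/J => hJ.
  have -> : (s ^+ 2 / 8 = s ^+ 2 / 4 * 2^-1)%R by field.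
  rewrite EFinM lee_wpmul2l//; first by rewrite lee_fin divr_ge0// sqr_ge0.
  rewrite leeBrDr; last exact: fin_num_measure.
  have -> : 1%E = (2^-1 + 2^-1)%:E :> \bar R by congr (_%:E); field.
  by rewrite EFinD leeD2l.
apply: ge0_le_integral => //.
- by move=> x _; rewrite -EFinM lee_fin mulr_ge0// divr_ge0// sqr_ge0.
- by apply: emeasurable_funM => //; apply/measurable_EFinP; exact: measurable_indic.
- by apply/measurable_EFinP; exact: measurable_funX.
- move=> x _; rewrite -EFinM lee_fin indicE.
  have [|] := boolP (x \in ~` J); last by rewrite mulr0 sqr_ge0.
  rewrite inE /J/= in_itv/= -ler_norml => /negP; rewrite -ltNge mulr1 => h.
  rewrite -[leRHS]real_normK ?num_real//.
  have -> : (s ^+ 2 / 4 = (`|s| / 2) ^+ 2)%R.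
    rewrite expr_div_n real_normK ?num_real//; by field.
  by rewrite ler_pXn2r ?nnegrE ?divr_ge0// ltW.
Qed.

(** Both s^2 and m^2 are controlled by the second moment v about 0: the first
    by [normal_var_le], the second because m^2 <= 2 x^2 + 2 (x-m)^2 for all x.
    Then x^2 <= 2 m^2 + 2 (x-m)^2 reduces to the central moment. *)
Lemma normal_moment_le (n : nat) :
  exists2 C : R, (0 < C)%R & forall m s v : R, s != 0%R ->
  \int[normal_prob m s]_x (x ^+ 2)%:E = v%:E ->
  \int[normal_prob m s]_x (x ^+ (2 * n))%:E <= (C * v ^+ n)%:E.
Proof.
have [C1 C10 h1] := normal_central_moment_le 1.
have [Cn Cn0 hn] := normal_central_moment_le n.
exists (4 ^+ n * ((2 + 16 * C1) ^+ n + Cn * 8 ^+ n))%R.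
  by rewrite mulr_gt0 ?exprn_gt0// addr_gt0 ?exprn_gt0// ?mulr_gt0 ?exprn_gt0//; lra.
move=> m s v s0 vE.
have mc k : measurable_fun setT (fun x : measurableTypeR R => ((x - m) ^+ k)%:E).
  by apply/measurable_EFinP; apply: measurable_funX; exact: measurable_funB.
have mx k : measurable_fun setT (fun x : measurableTypeR R => (x ^+ k)%:E).
  by apply/measurable_EFinP; apply: measurable_funX.
have s2v : (s ^+ 2 <= 8 * v)%R.
  by have := normal_var_le m s0; rewrite vE lee_fin; lra.
have v0 : (0 <= v)%R by have := sqr_ge0 s; lra.
have m2v : (m ^+ 2 <= (2 + 16 * C1) * v)%R.
  have : (m ^+ 2)%:E <= 2%:E * v%:E + 2%:E * (C1 * s ^+ 2)%:E.
    apply: (@le_trans _ _ (\int[normal_prob m s]_x (2%:E * (x ^+ 2)%:E +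
        2%:E * ((x - m) ^+ (2 * 1))%:E))).
      rewrite -[leLHS]mule1 -(probability_setT (normal_prob m s)) -integral_cst//.
      apply: ge0_le_integral => //.
      - by move=> x _; rewrite lee_fin sqr_ge0.
      - by apply: emeasurable_funD; apply: emeasurable_funM.
      - move=> x _; rewrite /= -!EFinM -EFinD lee_fin.
        rewrite -subr_ge0 (_ : _ - _ = (2 * x - m) ^+ 2)%R ?sqr_ge0//.
        by ring.
    rewrite ge0_integralD//.
    - rewrite !ge0_integralZl//.
      + rewrite vE leeD2l// lee_wpmul2l//.
        exact: h1.
      + by move=> x _; rewrite lee_fin sqr_ge0.
      + by move=> x _; rewrite lee_fin sqr_ge0.
    - by move=> x _; rewrite -EFinM lee_fin mulr_ge0// sqr_ge0.
    - exact: emeasurable_funM.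
    - by move=> x _; rewrite -EFinM lee_fin mulr_ge0// sqr_ge0.
    - exact: emeasurable_funM.
  rewrite -!EFinM -EFinD lee_fin => /le_trans; apply.
  have := ler_wpM2l (ltW C10) s2v; lra.
have C4 : (0 <= 4 ^+ n :> R)%R by exact: exprn_ge0.
apply: (@le_trans _ _ (\int[normal_prob m s]_x ((4 ^+ n)%:E * ((m ^+ (2 * n))%:E +
    ((x - m) ^+ (2 * n))%:E)))).
  apply: ge0_le_integral => //.
  - by move=> x _; rewrite lee_fin exprM exprn_ge0// sqr_ge0.
  - by apply: emeasurable_funM => //; exact: emeasurable_funD.
  - move=> x _; rewrite -EFinD -EFinM lee_fin !exprM.
    set a := (m ^+ 2)%R; set b := ((x - m) ^+ 2)%R.
    have a0 : (0 <= a)%R by exact: sqr_ge0.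
    have b0 : (0 <= b)%R by exact: sqr_ge0.
    have xab : (x ^+ 2 <= 4 * Num.max a b)%R.
      apply: (@le_trans _ _ (2 * a + 2 * b)%R).
        rewrite -subr_ge0 (_ : _ - _ = (2 * m - x) ^+ 2)%R ?sqr_ge0//.
        by rewrite /a /b; ring.
      have : (a <= Num.max a b)%R by rewrite le_max lexx.
      have : (b <= Num.max a b)%R by rewrite le_max lexx orbT.
      lra.
    have xn : ((x ^+ 2) ^+ n <= (4 * Num.max a b) ^+ n)%R.
      rewrite lerXn2r ?nnegrE ?sqr_ge0//.
      by rewrite mulr_ge0// le_max a0.
    apply: (le_trans xn); rewrite exprMn ler_wpM2l//.
    by rewrite /Num.max; case: ifP => _; rewrite ?lerDl ?lerDr exprn_ge0.
rewrite ge0_integralZl//; last 2 first.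
- exact: emeasurable_funD.
- by move=> x _; rewrite -EFinD lee_fin addr_ge0// exprM exprn_ge0// sqr_ge0.
rewrite -mulrA EFinM lee_wpmul2l//.
rewrite ge0_integralD//; last 2 first.
- by move=> x _; rewrite lee_fin exprM exprn_ge0// sqr_ge0.
- by move=> x _; rewrite lee_fin exprM exprn_ge0// sqr_ge0.
rewrite integral_cst// [X in _ * X + _](_ : _ = 1); last exact: probability_setT.
rewrite mule1 mulrDl EFinD leeD//.
  by rewrite lee_fin exprM -exprMn lerXn2r ?nnegrE ?sqr_ge0// (le_trans (sqr_ge0 _) m2v).
apply: (le_trans (hn _ _ s0)); rewrite lee_fin -mulrA ler_wpM2l ?(ltW Cn0)//.
by rewrite exprM -exprMn lerXn2r ?nnegrE ?sqr_ge0// (le_trans (sqr_ge0 _) s2v).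
Qed.
End gaussian_moments.

Section gaussian_variables.
Context {R : realType}.
Local Open Scope ereal_scope.

(** The only property of Gaussian laws that the estimates below use. *)
Lemma gaussian_moment_le (n : nat) :
  exists2 C : R, (0 < C)%R &
  forall d (T : measurableType d) (P : probability T R) (Y : T -> R) (v : R),
    gaussian P Y -> \int[P]_w (Y w ^+ 2)%:E = v%:E ->
    \int[P]_w (Y w ^+ (2 * n))%:E <= (C * v ^+ n)%:E.
Proof.
have [C C0 hC] := @normal_moment_le R n.
exists (C + 1)%R; first by rewrite addr_gt0.
move=> d T P Y v [mY [m [s PY]]].
(* The Borel sigma-algebra of R is presented on two types with different
   displays; normal laws live on the second one. *)
pose Y' : T -> measurableTypeR R := Y.
have mY' : measurable_fun setT Y' by exact: mY.
have law k : \int[P]_w (Y w ^+ (2 * k))%:E =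
    \int[pushforward P Y']_x (x ^+ (2 * k))%:E.
  rewrite ge0_integral_pushforward//.
  - by apply/measurable_EFinP; exact: measurable_funX.
  - by move=> y _; rewrite lee_fin exprM exprn_ge0// sqr_ge0.
have := law 1%N; rewrite muln1 => -> vE.
have v0 : (0 <= v)%R.
  by rewrite -lee_fin -vE integral_ge0// => x _; rewrite lee_fin sqr_ge0.
rewrite law mulrDl mul1r.
have mx k : measurable_fun setT (fun x : measurableTypeR R => (x ^+ k)%:E).
  by apply/measurable_EFinP; apply: measurable_funX.
have [s0|s0] := eqVneq s 0%R.
  have dir k : \int[pushforward P Y']_x (x ^+ k)%:E = (m ^+ k)%:E.
    rewrite (eq_measure_integral (\d_(m : measurableTypeR R)))//=.
      by rewrite integral_dirac ?diracE ?mem_set ?mul1e//; exact: mx.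
    by move=> A mA _; have := PY A mA; rewrite s0 eqxx.
  move: vE; rewrite !dir => -[<-]; rewrite lee_fin exprM lerDr.
  by apply: mulr_ge0; [exact: ltW|rewrite exprn_ge0 ?sqr_ge0].
have gau k : \int[pushforward P Y']_x (x ^+ k)%:E =
    \int[normal_prob m s]_x (x ^+ k)%:E.
  by apply: eq_measure_integral => A mA _; have := PY A mA; rewrite (negbTE s0).
move: vE; rewrite !gau => vE.
by apply: (le_trans (hC _ _ _ s0 vE)); rewrite lee_fin lerDl exprn_ge0.
Qed.

End gaussian_variables.

Section fBm_increments.
Local Open Scope ereal_scope.
Context d (T : measurableType d) (R : realType) (P : probability T R).
Variables (H : R) (X : R -> T -> R).
Hypotheses (H0 : (0 < H)%R) (fX : is_fBm P H X).

Lemma is_fBm_gaussian t : (0 <= t)%R -> gaussian P (X t).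
Proof.
move=> t0; case: fX => gX _ _ _.
have := gX 1%N (fun=> 1%R) (fun=> t) (fun=> t0).
by under eq_fun do rewrite big_ord1 mul1r.
Qed.

Lemma is_fBm_gaussianB s t : (0 <= s)%R -> (0 <= t)%R ->
  gaussian P (X t \- X s)%R.
Proof.
move=> s0 t0; case: fX => gX _ _ _.
have h (i : 'I_2) : (0 <= (if val i == 0%N then t else s))%R by case: ifP.
have := gX 2%N (fun i => if val i == 0%N then 1%R else (-1)%R) _ h.
under eq_fun do rewrite big_ord_recl big_ord1/= mul1r mulN1r.
by [].
Qed.

Lemma is_fBm_measurable t : (0 <= t)%R -> measurable_fun setT (X t).
Proof. by move=> /is_fBm_gaussian[]. Qed.

Lemma is_fBm_cov s t : (0 <= s)%R -> (0 <= t)%R ->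
  \int[P]_w (X s w * X t w)%:E =
  (2^-1 * (t `^ (2 * H) + s `^ (2 * H) - `|t - s| `^ (2 * H)))%:E.
Proof.
move=> s0 t0; case: fX => _ EX cX _; rewrite -cX// unlock !EX//= unlock.
by apply: eq_integral => w _ /=; rewrite !fctE/= !subr0.
Qed.

Lemma is_fBm_sqr t : (0 <= t)%R -> \int[P]_w (X t w ^+ 2)%:E = (t `^ (2 * H))%:E.
Proof.
move=> t0; under eq_integral do rewrite expr2.
rewrite is_fBm_cov// subrr normr0 powR0; last by rewrite mulf_neq0// gt_eqF.
by congr (_%:E); field.
Qed.

Lemma is_fBm_integrableM s t : (0 <= s)%R -> (0 <= t)%R ->
  P.-integrable setT (fun w => (X s w * X t w)%:E).
Proof.
move=> s0 t0; apply/integrableP.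
have ms := is_fBm_measurable s0; have mt := is_fBm_measurable t0.
split; first by apply/measurable_EFinP; exact: measurable_funM.
apply: (@le_lt_trans _ _ (\int[P]_w ((X s w ^+ 2)%:E + (X t w ^+ 2)%:E))).
  apply: ge0_le_integral => //.
  - by apply/measurable_EFinP; apply: measurableT_comp => //; exact: measurable_funM.
  - by apply: emeasurable_funD; apply/measurable_EFinP; exact: measurable_funX.
  - move=> w _; rewrite -EFinD/= lee_fin ler_norml; apply/andP; split.
      by have := sqr_ge0 (X s w + X t w)%R; rewrite sqrrD; nra.
    by have := sqr_ge0 (X s w - X t w)%R; rewrite sqrrB; nra.
rewrite ge0_integralD//.
- by rewrite !is_fBm_sqr// ltry.
- by move=> w _; rewrite lee_fin sqr_ge0.
- by apply/measurable_EFinP; exact: measurable_funX.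
- by move=> w _; rewrite lee_fin sqr_ge0.
- by apply/measurable_EFinP; exact: measurable_funX.
Qed.

Lemma is_fBm_sqrB s t : (0 <= s)%R -> (0 <= t)%R ->
  \int[P]_w ((X t w - X s w) ^+ 2)%:E = (`|t - s| `^ (2 * H))%:E.
Proof.
move=> s0 t0.
have itt := is_fBm_integrableM t0 t0.
have ist := is_fBm_integrableM s0 t0.
have iss := is_fBm_integrableM s0 s0.
transitivity (\int[P]_w ((X t w * X t w)%:E +
   ((X s w * X s w)%:E - (2%:E * (X s w * X t w)%:E)))).
  apply: eq_integral => w _; rewrite -!EFinM -EFinB -EFinD; congr (_%:E); ring.
rewrite integralD//; last by apply: integrableB => //; exact: integrableZl.
rewrite integralB//; last exact: integrableZl.
rewrite integralZl// !is_fBm_cov// !subrr normr0 powR0; last first.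
  by rewrite mulf_neq0// gt_eqF.
rewrite -!EFinM -EFinB -EFinD; by congr (_%:E); field.
Qed.

End fBm_increments.

Section fBm_moments.
Context {R : realType}.
Local Open Scope ereal_scope.

Lemma is_fBm_moment_le (n : nat) (H : R) : (0 < H)%R ->
  exists2 C : R, (0 < C)%R &
  forall d (T : measurableType d) (P : probability T R) X, is_fBm P H X ->
  (forall t, (0 <= t)%R ->
    \int[P]_w (X t w ^+ (2 * n))%:E <= (C * t `^ (2 * H * n%:R))%:E) /\
  (forall s t, (0 <= s <= t)%R ->
    \int[P]_w ((X t w - X s w) ^+ (2 * n))%:E <=
    (C * (t - s) `^ (2 * H * n%:R))%:E).
Proof.
move=> H0; have [C C0 hC] := @gaussian_moment_le R n.
exists C => // d T P X fX; split.
  move=> t t0; rewrite powRrM powR_mulrn ?powR_ge0//.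
  by apply: hC; [exact: is_fBm_gaussian fX _ t0|exact: is_fBm_sqr].
move=> s t /andP[s0 st]; rewrite powRrM powR_mulrn ?powR_ge0//.
have t0 := le_trans s0 st.
apply: (hC _ _ _ (X t \- X s)%R); first exact: is_fBm_gaussianB fX _ _ s0 t0.
rewrite (is_fBm_sqrB H0 fX)// ger0_norm// subr_ge0//.
Qed.

End fBm_moments.

(** * Completeness of the space of square-integrable functions *)

Section L2unit_norm.
Context {R : realType}.
Implicit Types f g : L2unit R.
Local Notation mu := (lebesgue01 R).

Lemma measurable_L2unit f : measurable_fun setT (f : measurableTypeR R -> R).
Proof. by case: f => f [[mf] ?]. Qed.

Lemma L2norm_ge0 f : 0 <= L2norm f.
Proof. by rewrite fine_ge0// Lnorm_ge0. Qed.

Lemma L2norm_sqr f : ((L2norm f ^+ 2)%:E = \int[mu]_x (f x ^+ 2)%:E)%E.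
Proof.
have n20 : 2%:R != 0 :> R by rewrite pnatr_eq0.
rewrite -powR_mulrn ?L2norm_ge0// -poweR_EFin /L2norm finite_norm_fine.
rewrite poweR_Lnorm//; apply: eq_integral => x _ /=.
by rewrite powR_mulrn// real_normK// num_real.
Qed.

Lemma L2normD f g : L2norm (f + g) <= L2norm f + L2norm g.
Proof. exact: ler_LnormD. Qed.

Lemma L2normN f : L2norm (- f) = L2norm f.
Proof. exact: LnormrN. Qed.

Lemma L2normB f g : L2norm (f - g) = L2norm (g - f).
Proof. by rewrite -L2normN opprB. Qed.

Lemma L2norm_triangle f g h : L2norm (f - h) <= L2norm (f - g) + L2norm (g - h).
Proof. by rewrite (le_trans _ (L2normD _ _))// addrA subrK. Qed.

End L2unit_norm.

Section Riesz_Fischer.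
Context {R : realType}.
Local Notation mu := (lebesgue01 R).
Local Open Scope ereal_scope.

Lemma limn_einf_le (u : (\bar R)^nat) (c : \bar R) :
  (\forall n \near \oo, u n <= c) -> limn_einf u <= c.
Proof.
move=> [N _ uc]; rewrite limn_einf_lim; apply: lime_le; first exact: is_cvg_einfs.
near=> n; apply: (@le_trans _ _ (u (maxn n N))).
  by apply: ereal_inf_lbound; exists (maxn n N) => //=; exact: leq_maxl.
by apply: uc => /=; exact: leq_maxr.
Unshelve. all: by end_near. Qed.

Lemma nneseries_ltye_cvg_series (a : R^nat) : (forall n, 0 <= a n)%R ->
  \sum_(n <oo) (a n)%:E < +oo -> cvgn (series a).
Proof.
move=> a0 aoo; apply: nondecreasing_is_cvgn.
  by apply/nondecreasing_seqP => n; rewrite seriesSr lerDl.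
exists (fine (\sum_(n <oo) (a n)%:E)) => _ [n _ <-].
rewrite -lee_fin fineK.
  by rewrite /series/= -sumEFin; apply: nneseries_lim_ge => k _ _; rewrite lee_fin.
by rewrite ge0_fin_numE// nneseries_ge0// => k _ _; rewrite lee_fin.
Qed.

Lemma L2unit_exists (f : measurableTypeR R -> R) : measurable_fun setT f ->
  \int[mu]_x (f x ^+ 2)%:E < +oo -> exists z : L2unit R, (z : _ -> R) = f.
Proof.
move=> mf foo; have fL : f \in Lfun mu 2%:R%:E.
  apply/andP; split; rewrite inE/=; first exact: mf.
  rewrite /finite_norm unlock poweR_lty//.
  apply: le_lt_trans foo; rewrite le_eqVlt; apply/orP; left; apply/eqP.
  by apply: eq_integral => x _ /=; rewrite powR_mulrn// real_normK// num_real.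
by exists (Lfun_Sub (lee1n 2) fL).
Qed.

(** On a probability space, |y| <= c + y^2 / c with c = 2^(-j) turns the
    geometric L^2 bound on the steps into a geometric L^1 bound.  So the sum of
    the steps |v (j+1) - v j| is integrable, hence finite almost everywhere. *)
Lemma L2norm_summable_ae_cvg (v : nat -> L2unit R) :
  (forall j, L2norm (v j.+1 - v j) <= 2 * (2 ^+ j)^-1)%R ->
  {ae mu, forall x, cvgn (fun j => v j x)}.
Proof.
move=> vj.
have mD j : measurable_fun setT (fun x : measurableTypeR R => v j.+1 x - v j x)%R.
  by apply: measurable_funB; exact: measurable_L2unit.
have mnD j : measurable_fun setT
    (fun x : measurableTypeR R => `|v j.+1 x - v j x|%:E).
  by apply/measurable_EFinP; exact: measurableT_comp.
have nD0 (j : nat) (x : measurableTypeR R) : setT x -> 0 <= `|v j.+1 x - v j x|%:E.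
  by rewrite lee_fin.
have L1 j : \int[mu]_x `|v j.+1 x - v j x|%:E <= (10 / (2 ^ j.+1)%:R)%:E.
  pose c : R := ((2 ^+ j)^-1)%R.
  have c0 : (0 < c)%R by rewrite invr_gt0 exprn_gt0.
  apply: (@le_trans _ _ (\int[mu]_x (c%:E + c^-1%:E * ((v j.+1 - v j)%R x ^+ 2)%:E))).
    apply: ge0_le_integral => //.
    - apply: emeasurable_funD => //; apply: emeasurable_funM => //.
      by apply/measurable_EFinP; apply: measurable_funX; exact: measurable_L2unit.
    - move=> x _; rewrite -EFinM -EFinD lee_fin /=.
      set y := (v j.+1 x - v j x)%R.
      rewrite -[X in (_ <= _ + _ * X)%R]real_normK ?num_real//.
      have := normr_ge0 y; set b := `|y|%R => b0.
      have [bc|cb] := leP b c.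
        by rewrite (le_trans bc)// lerDl mulr_ge0 ?invr_ge0 ?(ltW c0)// sqr_ge0.
      rewrite (@le_trans _ _ (c^-1 * b ^+ 2))%R//; last by rewrite lerDr ltW.
      by rewrite mulrC ler_pdivlMr// expr2 ler_wpM2l// ltW.
  rewrite ge0_integralD//; last 3 first.
  - by move=> x _; rewrite lee_fin ltW.
  - by move=> x _; rewrite -EFinM lee_fin mulr_ge0 ?invr_ge0 ?(ltW c0)// sqr_ge0.
  - apply: emeasurable_funM => //.
    by apply/measurable_EFinP; apply: measurable_funX; exact: measurable_L2unit.
  rewrite integral_cst// lebesgue01_setT mule1 ge0_integralZl//; last 3 first.
  - by apply/measurable_EFinP; apply: measurable_funX; exact: measurable_L2unit.
  - by move=> x _; rewrite lee_fin sqr_ge0.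
  - by rewrite lee_fin invr_ge0 ltW.
  rewrite -L2norm_sqr -EFinM -EFinD lee_fin.
  have -> : (10 / (2 ^ j.+1)%:R = c + c^-1 * (2 * c) ^+ 2 :> R)%R.
    rewrite natrX exprS invfM -/c.
    by field; rewrite gt_eqF.
  rewrite lerD2l ler_wpM2l ?invr_ge0 ?(ltW c0)//.
  by rewrite ler_pXn2r ?nnegrE ?L2norm_ge0 ?mulr_ge0// ltW.
pose g (x : measurableTypeR R) := \sum_(j <oo) `|v j.+1 x - v j x|%:E.
have g0 x : 0 <= g x by apply: nneseries_ge0 => j _ _; rewrite lee_fin.
have mg : measurable_fun setT g by exact: ge0_emeasurable_sum.
have gi : mu.-integrable setT g.
  apply/integrableP; split => //.
  under eq_integral => x _ do rewrite gee0_abs//.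
  rewrite integral_nneseries//.
  have := @epsilon_trick R (fun=> 0) 10%R xpredT (fun=> lexx _) (ler0n _ _).
  rewrite [X in X + _]eseries0// add0e => h.
  apply: le_lt_trans (ltry 10%R); apply: le_trans h.
  apply: lee_nneseries => j _; first by move=> _; exact: integral_ge0.
  by rewrite add0e.
have := integrable_ae measurableT gi; apply: filterS => x /(_ I) gx.
have : cvgn [normed series (telescope (fun j => v j x))].
  apply: (@nneseries_ltye_cvg_series (fun n => `|telescope (fun j => v j x) n|%R)) => //.
  by move: gx; rewrite ge0_fin_numE.
move=> /normed_cvg h.
rewrite (_ : (fun j => v j x) = (fun n => v 0%N x + series (telescope (fun j => v j x)) n)%R).
  by apply: is_cvgD => //; exact: is_cvg_cst.
by apply/funext => n; exact: eq_sum_telescope.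
Qed.

(** Riesz-Fischer theorem.  A fast subsequence converges almost everywhere by
    [L2norm_summable_ae_cvg], and Fatou's lemma bounds the distance of u n to
    its pointwise limit by the Cauchy bound. *)
Lemma L2unit_complete (u : nat -> L2unit R) :
  (forall e : R, 0 < e -> exists N, forall m n, (N <= m)%N -> (N <= n)%N ->
     L2norm (u m - u n) <= e)%R ->
  exists z : L2unit R, ((fun n => L2norm (u n - z)) @ \oo --> 0)%R.
Proof.
move=> uC.
have /choice[N hN] : forall j : nat, exists N, (j <= N)%N /\
    forall m n, (N <= m)%N -> (N <= n)%N -> (L2norm (u m - u n) <= (2 ^+ j)^-1)%R.
  move=> j; have [|N hN] := uC (2 ^+ j)^-1%R; first by rewrite invr_gt0 exprn_gt0.
  exists (maxn j N); split; first exact: leq_maxl.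
  by move=> m n; rewrite !geq_max => /andP[_ m1] /andP[_ n1]; exact: hN.
pose v j := u (N j).
have vC : {ae mu, forall x, cvgn (fun j => v j x)}.
  apply: L2norm_summable_ae_cvg => j; rewrite /v.
  apply: le_trans (L2norm_triangle _ (u (maxn (N j) (N j.+1))) _) _.
  rewrite [leRHS]mulr_natl [leRHS]mulr2n lerD//.
    apply: le_trans ((hN j.+1).2 _ _ _ _) _; rewrite ?leq_maxr//.
    by rewrite lef_pV2 ?posrE ?exprn_gt0// ler_eXn2l// ltr1n.
  by apply: (hN j).2; rewrite ?leq_maxl.
pose f (x : measurableTypeR R) : R := fine (limn_esup (fun j => (v j x)%:E)).
have mf : measurable_fun setT f.
  apply: measurableT_comp => //; apply: measurable_fun_limn_esup => j.
  by apply/measurable_EFinP; exact: measurable_L2unit.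
have fE : {ae mu, forall x, (fun j => v j x) @ \oo --> f x}.
  apply: filterS vC => x vx; rewrite /f.
  have vx' : (fun j => (v j x)%:E) @ \oo --> (lim ((fun j => v j x) @ \oo))%:E.
    by apply: cvg_EFin; [exact: nearW|exact: vx].
  by rewrite (cvg_limn_einf_sup vx').2.
have key n e : (\forall m \near \oo, L2norm (u n - u m) <= e)%R ->
    \int[mu]_x ((u n x - f x) ^+ 2)%:E <= (e ^+ 2)%:E.
  move=> une.
  pose h j (x : measurableTypeR R) := ((u n x - v j x) ^+ 2)%:E.
  have mh j : measurable_fun setT (h j).
    apply/measurable_EFinP; apply: measurable_funX.
    by apply: measurable_funB; exact: measurable_L2unit.
  have h0 j x : setT x -> 0 <= h j x by move=> _; rewrite lee_fin sqr_ge0.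
  have mhf : measurable_fun setT (fun x : measurableTypeR R => ((u n x - f x) ^+ 2)%:E).
    apply/measurable_EFinP; apply: measurable_funX.
    by apply: measurable_funB => //; exact: measurable_L2unit.
  apply: (@le_trans _ _ (\int[mu]_x limn_einf (h ^~ x))).
    rewrite le_eqVlt; apply/orP; left; apply/eqP.
    apply: ae_eq_integral => //.
      rewrite (_ : (fun x => _) = (fun x => - limn_esup (fun j => - h j x))).
        apply: measurableT_comp => //; apply: measurable_fun_limn_esup => j.
        exact: measurableT_comp.
      apply/funext => x; rewrite -limn_einfN; congr limn_einf.
      by apply/funext => j /=; rewrite opprK.
    apply: filterS fE => x vx _; apply/esym.
    have hx : (h ^~ x) @ \oo --> ((u n x - f x) ^+ 2)%:E.
      apply: cvg_EFin; first exact: nearW.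
      apply: (@cvg_comp _ _ _ _ (fun y => y ^+ 2)%R); last exact: exprn_continuous.
      by apply: cvgB => //; exact: cvg_cst.
    by rewrite (cvg_limn_einf_sup hx).1.
  apply: le_trans (fatou mu measurableT mh h0) _.
  apply: limn_einf_le; case: une => M _ hM; exists M => // j /= Mj.
  rewrite /h; have := L2norm_sqr (u n - v j)%R => /= <-.
  rewrite lee_fin.
  have : (L2norm (u n - v j) <= e)%R.
    by apply: hM; apply: leq_trans Mj _; exact: (hN j).1.
  have := L2norm_ge0 (u n - v j)%R => l0 le; rewrite ler_pXn2r ?nnegrE//.
  exact: le_trans l0 le.
have utail e : (0 < e)%R -> \forall n \near \oo, \forall m \near \oo,
    (L2norm (u n - u m) <= e)%R.
  move=> e0; have [M hM] := uC e e0.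
  by exists M => // n /= Mn; exists M => // m /= Mm; exact: hM.
have [n0 hn0] : exists n, \int[mu]_x ((u n x - f x) ^+ 2)%:E < +oo.
  have [M _ hM] := utail 1%R ltr01; exists M.
  by apply: le_lt_trans (key _ _ (hM M (leqnn _))) (ltry _).
have mB : measurable_fun setT (fun x : measurableTypeR R => u n0 x - f x)%R.
  by apply: measurable_funB => //; exact: measurable_L2unit.
have [z' z'E] := L2unit_exists mB hn0.
(* Square-integrability is known for u n0 - f rather than for f itself. *)
exists (u n0 - z')%R.
have zE n : ((L2norm (u n - (u n0 - z')) ^+ 2)%:E =
    \int[mu]_x ((u n x - f x) ^+ 2)%:E)%E.
  rewrite L2norm_sqr; apply: eq_integral => x _ /=.
  by rewrite z'E subKr.
apply/cvgrPdist_le => e e0; apply: filterS (utail e e0) => n hn.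
rewrite sub0r normrN ger0_norm ?L2norm_ge0//.
rewrite -(@ler_pXn2r _ 2)// ?nnegrE ?L2norm_ge0 ?(ltW e0)//.
by rewrite -lee_fin zE; exact: key.
Qed.
End Riesz_Fischer.

(** * The sine basis *)

Section FTC.
Context {R : realType}.
Local Notation mu := (@lebesgue_measure R).

Lemma integral_is_derive (F f : R -> R) (a b : R) : a <= b ->
  (forall x : R, is_derive x (1 : R) F (f x)) -> continuous f ->
  (\int[mu]_(x in `[a, b]) (f x)%:E = (F b - F a)%:E)%E.
Proof.
move=> ab dF cf; have [<-|ab'] := eqVneq a b.
  by rewrite set_itv1 integral_set1 subrr.
have cF x : {for x, continuous F}.
  by apply: differentiable_continuous; apply/derivable1_diffP; exact: ex_derive.
rewrite (@continuous_FTC2 _ f F)//.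
- by rewrite lt_neqAle ab'.
- exact: continuous_subspaceT.
- split.
  + by move=> x _; exact: ex_derive.
  + exact/cvg_at_right_filter/cF.
  + exact/cvg_at_left_filter/cF.
- by move=> x _; rewrite derive1E derive_val.
Qed.

End FTC.

Section sine_basis.
Context {R : realType}.
Local Notation mu := (@lebesgue_measure R).

(** The case c = 0 is the one that the diagonal products of sines meet. *)
Definition cos_primitive (c x : R) := if c == 0 then x else sin (c * x) / c.

Lemma is_derive_cos_primitive (c x : R) :
  is_derive x (1 : R) (cos_primitive c) (cos (c * x)).
Proof.
rewrite /cos_primitive; case: eqVneq => [->|c0].
  by rewrite mul0r cos0; exact: is_derive_id.
have dc : is_derive x (1 : R) (fun y => c * y) c.
  have h := @is_deriveZ R R R id c x 1 1 (is_derive_id x 1).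
  by apply: (is_derive_eq h); exact: mulr1.
rewrite (_ : (fun y => sin (c * y) / c) = c^-1 \*: (sin \o (fun y => c * y))).
  have h := is_derive1_comp (is_derive_sin (c * x)) dc.
  apply: (is_derive_eq (is_deriveZ c^-1 h)).
  by rewrite /GRing.scale/=; field.
by apply/funext => y; rewrite /GRing.scale/= mulrC.
Qed.

Lemma sin_mulrn_pi n : sin (n%:R * pi) = 0 :> R.
Proof.
elim: n => [|n IH]; first by rewrite mul0r sin0.
by rewrite -natr1 mulrDl mul1r sinD sinpi IH mul0r mulr0 addr0.
Qed.

Lemma sin_intr_pi (z : int) : sin (z%:~R * pi) = 0 :> R.
Proof.
case: z => n; first by rewrite sin_mulrn_pi.
by rewrite NegzE mulrNz mulNr sinN sin_mulrn_pi oppr0.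
Qed.

Lemma eigenfunM k l x : eigenfun_fun k x * eigenfun_fun l x =
  cos ((k.+1%:R * pi - l.+1%:R * pi) * x) - cos ((k.+1%:R * pi + l.+1%:R * pi) * x) :> R.
Proof.
rewrite /eigenfun_fun mulrBl mulrDl cosB cosD.
have : Num.sqrt 2 * Num.sqrt 2 = 2 :> R by rewrite -expr2 sqr_sqrtr.
set a := Num.sqrt 2; set s := sin _; set t := sin _ => aa.
have -> : a * s * (a * t) = (a * a) * (s * t) by ring.
by rewrite aa; ring.
Qed.

Lemma continuous_eigenfun_fun k : continuous (@eigenfun_fun R k).
Proof.
move=> x; apply: cvgM; first exact: cvg_cst.
apply: (continuous_comp (f := fun x => k.+1%:R * pi * x) (g := sin)).
  by apply: cvgM; [exact: cvg_cst|exact: cvg_id].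
exact: continuous_sin.
Qed.

Definition eigenfunM_primitive (k l : nat) (x : R) : R :=
  cos_primitive (k.+1%:R * pi - l.+1%:R * pi) x -
  cos_primitive (k.+1%:R * pi + l.+1%:R * pi) x.

(** Orthonormality of the sines: the frequencies k - l and k + l + 2 are
    integer multiples of pi, so only a zero frequency contributes. *)
Lemma eigenfunM_primitive01 (k l : nat) :
  eigenfunM_primitive k l 1 - eigenfunM_primitive k l 0 = (k == l)%:R :> R.
Proof.
have pi0 : pi != 0 :> R by rewrite gt_eqF// pi_gt0.
have E (z : int) : cos_primitive (z%:~R * pi) 1 - cos_primitive (z%:~R * pi) 0
    = (z == 0)%:R :> R.
  rewrite /cos_primitive mulf_eq0 (negbTE pi0) orbF intr_eq0.
  case: eqVneq => _; first by rewrite subr0.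
  by rewrite mulr1 mulr0 sin0 sin_intr_pi mul0r subr0.
have := E (k.+1%:Z - l.+1%:Z)%R; have := E (k.+1%:Z + l.+1%:Z)%R.
rewrite intrD intrB !mulrDl mulNr -!pmulrn /eigenfunM_primitive.
set a := cos_primitive _ 1; set b := cos_primitive _ 0.
set a' := cos_primitive _ 1; set b' := cos_primitive _ 0.
rewrite subr_eq0 => h1 h2.
have -> : a' - a - (b' - b) = (a' - b') - (a - b) by ring.
by rewrite h1 h2 subr0 eqz_nat eqSS.
Qed.

End sine_basis.

Section eigen_sums.
Context {R : realType}.
Local Notation mu := (@lebesgue_measure R).

Lemma integral_lebesgue01 (f : measurableTypeR R -> \bar R) :
  measurable_fun setT f -> (forall x, 0 <= f x)%E ->
  (\int[lebesgue01 R]_x f x = \int[mu]_(x in `[0%R, 1%R]) f x)%E.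
Proof.
move=> mf f0; pose D : set (measurableTypeR R) := `]0, 1[%classic.
have mD : measurable D by exact: measurable_itv.
have mDC : measurable (~` D) by exact: measurableC.
rewrite (@ge0_negligible_integral _ _ _ (lebesgue01 R) setT (~` D))//; last first.
  by rewrite /lebesgue01/= /mrestr setICl measure0.
rewrite setTD setCK (@integral_itv_bndoo _ 0 1 f true false); last first.
  exact: measurable_funTS.
apply: eq_measure_integral => A mA AD.
by rewrite /lebesgue01/= /mrestr; congr (mu _); exact: setIidl.
Qed.

Definition eigen_sum (a : nat -> R) n : L2unit R := \sum_(k < n) a k *: eigenfun R k.

Lemma eigen_sumE n (a : nat -> R) (x : R) :
  eigen_sum a n x = \sum_(k < n) a k * eigenfun_fun k x.
Proof. by rewrite /eigen_sum; elim/big_rec2 : _ => // k y z _ /= <-. Qed.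

(** Pythagoras: the squared sum is expanded into a double sum of products,
    which has an explicit primitive. *)
Lemma L2norm_eigen_sum n (a : nat -> R) :
  L2norm (eigen_sum a n) ^+ 2 = \sum_(k < n) a k ^+ 2.
Proof.
apply/EFin_inj; rewrite L2norm_sqr integral_lebesgue01; last 2 first.
- apply/measurable_EFinP; apply: measurable_funX; exact: measurable_L2unit.
- by move=> x; rewrite lee_fin sqr_ge0.
pose f (x : R) := \sum_(k < n) \sum_(l < n) a k * a l * (eigenfun_fun k x * eigenfun_fun l x).
pose F := \sum_(k < n) \sum_(l < n) (a k * a l) \*: (eigenfunM_primitive k l : R -> R).
transitivity (\int[mu]_(x in `[0%R, 1%R]) (f x)%:E)%E.
  apply: eq_integral => x _; rewrite eigen_sumE expr2 mulr_suml; congr (_%:E).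
  apply: eq_bigr => k _; rewrite mulr_sumr; apply: eq_bigr => l _.
  by rewrite mulrACA.
have dF x : is_derive x (1 : R) F (f x).
  apply: is_derive_sum => k; apply: is_derive_sum => l.
  apply: is_deriveZ; rewrite eigenfunM.
  by apply: is_deriveB; exact: is_derive_cos_primitive.
have cf : continuous f.
  move=> x; apply: cvg_big => [|k _]; first exact: add_continuous.
  apply: cvg_big => [|l _]; first exact: add_continuous.
  apply: cvgM; first exact: cvg_cst.
  by apply: cvgM; exact: continuous_eigenfun_fun.
rewrite (integral_is_derive ler01 dF cf); congr (_%:E).
have FE x : F x = \sum_(k < n) \sum_(l < n) a k * a l * eigenfunM_primitive k l x.
  rewrite /F fct_sumE; apply: eq_bigr => k _; rewrite fct_sumE.
  by apply: eq_bigr.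
rewrite !FE -sumrB; apply: eq_bigr => k _.
rewrite -sumrB (bigD1 k)//= big1.
  by rewrite -mulrBr eigenfunM_primitive01 eqxx mulr1 addr0 expr2.
move=> l; rewrite -val_eqE/= => /negbTE lk.
by rewrite -mulrBr eigenfunM_primitive01 eq_sym lk mulr0.
Qed.

End eigen_sums.

Section eigen_series.
Context {R : realType}.
Implicit Types a : nat -> R.

Lemma eigen_sumB a c n : eigen_sum a n - eigen_sum c n =
  eigen_sum (fun k => a k - c k) n.
Proof. by rewrite /eigen_sum -sumrB; apply: eq_bigr => k _; rewrite scalerBl. Qed.

Lemma L2norm_eigen_sum_tail a m n : (n <= m)%N ->
  L2norm (eigen_sum a m - eigen_sum a n) ^+ 2 =
  \sum_(k < m) a k ^+ 2 - \sum_(k < n) a k ^+ 2.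
Proof.
move=> nm; pose c k := if (k < n)%N then 0 else a k.
have -> : eigen_sum a m - eigen_sum a n = eigen_sum c m.
  rewrite /eigen_sum -!(big_mkord xpredT (fun k => a k *: eigenfun R k)).
  rewrite -(big_mkord xpredT (fun k => c k *: eigenfun R k)).
  rewrite (@big_cat_nat _ _ _ n)//= [RHS](@big_cat_nat _ _ _ n)//=.
  rewrite addrAC subrr add0r [X in _ = X + _](_ : _ = 0) ?add0r.
    by apply: eq_big_nat => k /andP[nk _]; rewrite /c ltnNge nk.
  by rewrite big_nat big1// => k /= kn; rewrite /c kn scale0r.
rewrite L2norm_eigen_sum -!(big_mkord xpredT (fun k => a k ^+ 2)).
rewrite -(big_mkord xpredT (fun k => c k ^+ 2)).
rewrite (@big_cat_nat _ _ _ n)//= [in RHS](@big_cat_nat _ _ _ n)//=.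
rewrite [RHS]addrAC subrr add0r [X in X + _ = _](_ : _ = 0) ?add0r.
  by apply: eq_big_nat => k /andP[nk _]; rewrite /c ltnNge nk.
by rewrite big_nat big1// => k /= kn; rewrite /c kn expr0n.
Qed.

(** By [L2norm_eigen_sum_tail] the partial sums are Cauchy when their squared
    norms, which increase, are bounded. *)
Lemma eigen_sum_cvg a B : (forall n, \sum_(k < n) a k ^+ 2 <= B) ->
  exists z : L2unit R, (fun n => L2norm (eigen_sum a n - z)) @ \oo --> 0.
Proof.
move=> aB; apply: L2unit_complete => e e0.
pose s n := \sum_(k < n) a k ^+ 2.
have nds : nondecreasing_seq s.
  by apply/nondecreasing_seqP => n; rewrite /s big_ord_recr/= lerDl sqr_ge0.
have sc : cvgn s.
  by apply: nondecreasing_is_cvgn => //; exists B => _ [n _ <-]; exact: aB.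
have sl n : s n <= limn s by exact: nondecreasing_cvgn_le.
have e20 : 0 < e ^+ 2 by rewrite exprn_gt0.
have [N _ hN] : \forall n \near \oo, `|limn s - s n| <= e ^+ 2.
  by move/cvgrPdist_le : sc; apply.
have lN : limn s - s N <= e ^+ 2.
  by apply: le_trans (hN N _) => /=; [exact: ler_norm|exact: leqnn].
exists N => m n.
wlog nm : m n / (n <= m)%N => [H|] Nm Nn.
  by case/orP : (leq_total n m) => nm; [|rewrite L2normB]; apply: H.
rewrite -(@ler_pXn2r _ 2)// ?nnegrE ?L2norm_ge0 ?(ltW e0)//.
rewrite L2norm_eigen_sum_tail// -/(s m) -/(s n).
by have := sl m; have : s N <= s n by [exact: nds]; lra.
Qed.

Lemma L2norm_cvg_limit_le (u v : nat -> L2unit R) (y z : L2unit R) (n : nat) (B : R) :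
  (fun k => L2norm (u k - y)) @ \oo --> 0 ->
  (fun k => L2norm (v k - z)) @ \oo --> 0 ->
  (forall k, L2norm (u k - v k) ^+ n <= B) -> L2norm (y - z) ^+ n <= B.
Proof.
move=> uy vz uvB.
have h : (fun k => L2norm (u k - v k)) @ \oo --> L2norm (y - z).
  have h0 : (fun k => L2norm (u k - y) + L2norm (v k - z)) @ \oo --> 0.
    by rewrite -[X in _ --> X]addr0; exact: cvgD.
  apply/cvgrPdist_le => e e0.
  move/cvgrPdist_le/(_ _ e0) : h0; apply: filterS => k.
  rewrite sub0r normrN ger0_norm ?addr_ge0 ?L2norm_ge0// => hk.
  have := L2norm_triangle y (u k) z; have := L2norm_triangle (u k) (v k) z.
  have := L2norm_triangle (u k) y (v k); have := L2norm_triangle y z (v k).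
  rewrite (L2normB z) (L2normB y (u k)) ler_norml => *.
  by apply/andP; split; lra.
have hn : (fun k => L2norm (u k - v k) ^+ n) @ \oo --> L2norm (y - z) ^+ n.
  exact: (cvg_comp _ _ h (@exprn_continuous R n _)).
rewrite -(cvg_lim _ hn)//; apply: limr_le; first by apply/cvg_ex; exists (L2norm (y - z) ^+ n).
exact: nearW.
Qed.

End eigen_series.

(** * Pathwise analysis of one coordinate *)

Section ou_kernel.
Context {R : realType}.
Local Notation mu := (@lebesgue_measure R).
Implicit Types (lam a t s y : R) (b : R -> R).

(** On [a, t] this density has mass 1 - exp (- lam (t - a)); a point mass
    exp (- lam (t - a)) completes it into a probability. *)
Definition ou_kernel lam t s := lam * expR (- (lam * (t - s))).

Lemma ou_kernel_ge0 lam t s : 0 <= lam -> 0 <= ou_kernel lam t s.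
Proof. by move=> lam0; rewrite mulr_ge0// expR_ge0. Qed.

Lemma is_derive_ou_kernel lam t s : is_derive s (1 : R)
  (fun s => expR (- (lam * (t - s)))) (ou_kernel lam t s).
Proof.
have h1 : is_derive s (1 : R) (fun s => - (lam * (t - s))) lam.
  rewrite (_ : (fun s => _) = (fun=> - (lam * t)) \+ lam \*: id); last first.
    by apply/funext => u /=; rewrite /GRing.scale/=; ring.
  have h := is_deriveD (is_derive_cst (- (lam * t)) s 1)
    (@is_deriveZ R R R id lam s 1 1 (is_derive_id s 1)).
  by apply: (is_derive_eq h); rewrite add0r; exact: mulr1.
have h := @is_derive1_comp R expR (fun s => - (lam * (t - s))) s _ lam
  (is_derive_expR _) h1.
by apply: (is_derive_eq h); rewrite mulrC.
Qed.

Lemma continuous_ou_kernel lam t : continuous (ou_kernel lam t).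
Proof.
move=> s; apply: cvgM; first exact: cvg_cst.
apply: continuous_comp; last exact: continuous_expR.
apply: cvgN; apply: cvgM; first exact: cvg_cst.
by apply: cvgB; [exact: cvg_cst|exact: cvg_id].
Qed.

Lemma integral_ou_kernel lam a t : a <= t ->
  (\int[mu]_(s in `[a, t]) (ou_kernel lam t s)%:E =
   (1 - expR (- (lam * (t - a))))%:E)%E.
Proof.
move=> at_; rewrite (integral_is_derive at_ (is_derive_ou_kernel lam t)).
  by rewrite subrr mulr0 oppr0 expR0.
exact: continuous_ou_kernel.
Qed.

Lemma integrable_itv_continuous (f : R -> R) a t :
  {within `[a, t], continuous f} -> mu.-integrable `[a, t] (EFin \o f).
Proof.
by move=> cf; apply: continuous_compact_integrable => //; exact: segment_compact.
Qed.

Lemma within_continuous_ou_kernelM (g : R -> R) lam a t :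
  {within `[a, t], continuous g} ->
  {within `[a, t], continuous (fun s => ou_kernel lam t s * g s)}.
Proof.
move=> cg x; apply: cvgM; last exact: cg.
exact: (continuous_subspaceT (@continuous_ou_kernel lam t)).
Qed.

End ou_kernel.

Section ou_path.
Context {R : realType}.
Local Notation mu := (@lebesgue_measure R).
Variables (lam : R) (b : R -> R).
Hypotheses (lam0 : 0 < lam) (cb : {within `[0, +oo[, continuous b}).
Implicit Types (a t s y : R).

(** The Wiener integral of exp (- lam (t - s)) against b over [0, t], after
    integration by parts. *)
Definition ou_int t := b t - \int[mu]_(s in `[0, t]) (ou_kernel lam t s * b s).

(** The average of the increments b t - b s under the probability of
    [ou_kernel], whose point mass is put on the increment b t - y. *)
Definition ou_incr a t y := expR (- (lam * (t - a))) * (b t - y) +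
  \int[mu]_(s in `[a, t]) (ou_kernel lam t s * (b t - b s)).

(** The average that Jensen's inequality puts above the n-th power of
    [ou_incr].  As an extended-real integral of a nonnegative function, it
    depends measurably on the path by Tonelli's theorem. *)
Definition ou_majorant n a t y : \bar R :=
  ((expR (- (lam * (t - a))) * `|b t - y| ^+ n)%:E +
  \int[mu]_(s in `[a, t]) (ou_kernel lam t s * `|b t - b s| ^+ n)%:E)%E.

Lemma wiener_int_ou t :
  wiener_int (fun s => expR (- (lam * (t - s)))) b t = ou_int t.
Proof.
rewrite /wiener_int subrr mulr0 oppr0 expR0 mul1r; congr (_ - _).
apply: eq_Rintegral => s _; congr (_ * _).
by rewrite derive1E (@derive_val _ _ _ _ _ _ _ (is_derive_ou_kernel lam t s)).
Qed.

Lemma cb_itv a t : 0 <= a -> {within `[a, t], continuous b}.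
Proof.
move=> a0; apply: continuous_subspaceW cb => s /=.
by rewrite !in_itv/= andbT => /andP[+ _]; exact: le_trans.
Qed.

Lemma cbB_itv a t : 0 <= a -> {within `[a, t], continuous (fun s => b t - b s)}.
Proof.
by move=> a0 x; apply: cvgB; [exact: cvg_cst|exact: (cb_itv a0)].
Qed.

Lemma ou_incrE a t y : 0 <= a <= t -> ou_incr a t y =
  b t - expR (- (lam * (t - a))) * y - \int[mu]_(s in `[a, t]) (ou_kernel lam t s * b s).
Proof.
move=> /andP[a0 at_]; rewrite /ou_incr.
under eq_Rintegral do rewrite mulrBr.
rewrite RintegralB//; last 2 first.
- by apply: integrable_itv_continuous; apply: within_continuous_ou_kernelM => x; exact: cvg_cst.
- by apply: integrable_itv_continuous; apply: within_continuous_ou_kernelM; exact: cb_itv.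
rewrite RintegralZr//; last first.
  by apply: integrable_itv_continuous; apply: continuous_subspaceT; exact: continuous_ou_kernel.
rewrite {1}/Rintegral integral_ou_kernel//=; ring.
Qed.

Lemma ou_int_incr0 t : 0 <= t -> ou_int t = ou_incr 0 t 0.
Proof. by move=> t0; rewrite ou_incrE ?lexx// mulr0 subr0. Qed.

(** The mild form of dZ = - lam Z dt + db between t1 and t2: the value at t1
    is damped, and the increments of b over [t1, t2] are added. *)
Lemma ou_intB t1 t2 : 0 <= t1 <= t2 -> ou_int t2 - ou_int t1 =
  (expR (- (lam * (t2 - t1))) - 1) * ou_int t1 + ou_incr t1 t2 (b t1).
Proof.
move=> /andP[t10 t12]; rewrite ou_incrE ?t10// /ou_int.
have iK : mu.-integrable `[0, t2] (EFin \o (fun s => ou_kernel lam t2 s * b s)).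
  by apply: integrable_itv_continuous; apply: within_continuous_ou_kernelM; exact: cb_itv.
have := @Rintegral_itvB _ (fun s => ou_kernel lam t2 s * b s) (BLeft 0) (BRight t2) t1 iK.
rewrite !bnd_simp => /(_ t10 t12); rewrite Rintegral_itv_obnd_cbnd; last first.
  by apply: integrableS iK => //; apply: subset_itvr; rewrite bnd_simp.
have -> : \int[mu]_(s in `[0, t1]) (ou_kernel lam t2 s * b s) =
    expR (- (lam * (t2 - t1))) * \int[mu]_(s in `[0, t1]) (ou_kernel lam t1 s * b s).
  rewrite -RintegralZl//; last first.
    by apply: integrable_itv_continuous; apply: within_continuous_ou_kernelM; exact: cb_itv.
  apply: eq_Rintegral => s _; rewrite /ou_kernel.
  have -> : - (lam * (t2 - s)) = - (lam * (t2 - t1)) + - (lam * (t1 - s)) by ring.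
  by rewrite expRD; ring.
by move=> <-; ring.
Qed.

(** Jensen's inequality: [exprS_tangent] at the mean m of the absolute
    increments is averaged, and the first-order term cancels. *)
Lemma ou_incr_le_majorant n a t y : 0 <= a <= t ->
  ((`|ou_incr a t y| ^+ n.+1)%:E <= ou_majorant n.+1 a t y)%E.
Proof.
move=> /andP[a0 at_].
set e := expR (- (lam * (t - a))).
have e0 : 0 <= e by exact: expR_ge0.
have cB := @cbB_itv a t a0.
have cN k : {within `[a, t], continuous (fun s => `|b t - b s| ^+ k)}.
  move=> x; apply: (@cvg_comp _ _ _ _ (fun u => u ^+ k)); last exact: exprn_continuous.
  by apply: cvg_norm; exact: cB.
have iN k : mu.-integrable `[a, t] (EFin \o (fun s => ou_kernel lam t s * `|b t - b s| ^+ k)).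
  by apply: integrable_itv_continuous; exact: within_continuous_ou_kernelM.
pose A k := \int[mu]_(s in `[a, t]) (ou_kernel lam t s * `|b t - b s| ^+ k).
pose x0 := `|b t - y|.
have x00 : 0 <= x0 by exact: normr_ge0.
pose m := e * x0 + A 1.
have A0 : 0 <= A 1.
  apply: Rintegral_ge0 => s _; rewrite mulr_ge0 ?exprn_ge0//.
  by rewrite ou_kernel_ge0// ltW.
have m0 : 0 <= m by rewrite addr_ge0 ?mulr_ge0.
have Im : `|ou_incr a t y| <= m.
  rewrite (le_trans (ler_normD _ _))// normrM (ger0_norm e0) lerD2l.
  apply: le_trans (le_normr_Rintegral _ _) _ => //.
    by apply: integrable_itv_continuous; exact: within_continuous_ou_kernelM.
  rewrite le_eqVlt; apply/orP; left; apply/eqP; apply: eq_Rintegral => s _.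
  by rewrite normrM expr1 (ger0_norm (ou_kernel_ge0 _ _ (ltW lam0))).
have A_E k : (\int[mu]_(s in `[a, t]) (ou_kernel lam t s * `|b t - b s| ^+ k)%:E = (A k)%:E)%E.
  by rewrite /A /Rintegral fineK; [|exact: (integrable_fin_num _ (iN k))].
rewrite /ou_majorant A_E -/e -/x0 -EFinD lee_fin.
apply: (@le_trans _ _ (m ^+ n.+1)); first by rewrite lerXn2r ?nnegrE.
have AK : \int[mu]_(s in `[a, t]) ou_kernel lam t s = 1 - e.
  by rewrite /Rintegral integral_ou_kernel.
have iK : mu.-integrable `[a, t] (EFin \o ou_kernel lam t).
  by apply: integrable_itv_continuous; apply: continuous_subspaceT; exact: continuous_ou_kernel.
have Jensen : (1 - e) * (m ^+ n.+1 - n.+1%:R * m ^+ n * m) +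
    n.+1%:R * m ^+ n * A 1 <= A n.+1.
  rewrite -AK -RintegralZr// -RintegralZl// -RintegralD//; last 2 first.
  - by apply: integrable_itv_continuous; apply: within_continuous_ou_kernelM => x; exact: cvg_cst.
  - apply: integrable_itv_continuous => x; apply: cvgM; first exact: cvg_cst.
    exact: (within_continuous_ou_kernelM (cN 1)).
  apply: le_Rintegral => //.
  - apply: integrable_itv_continuous => x; apply: cvgD.
      by apply: within_continuous_ou_kernelM => {}x; exact: cvg_cst.
    apply: cvgM; first exact: cvg_cst.
    exact: (within_continuous_ou_kernelM (cN 1)).
  - move=> s _; rewrite [X in _ + X]mulrCA -mulrDr ler_wpM2l ?ou_kernel_ge0 ?(ltW lam0)//.
    rewrite expr1; apply: le_trans (exprS_tangent n (normr_ge0 _) m0).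
    by rewrite mulrBr; lra.
have := ler_wpM2l e0 (exprS_tangent n (normr_ge0 (b t - y)) m0); rewrite -/x0 => T0.
apply: le_trans (lerD T0 Jensen).
rewrite -subr_ge0 (_ : _ - _ = n.+1%:R * m ^+ n * (e * x0 + A 1 - m)); last by ring.
by rewrite /m subrr mulr0.
Qed.

End ou_path.

(** * Moments of one coordinate *)

Section joint_measurability.
Context d (T : measurableType d) (R : realType).
Implicit Types X : R -> T -> R.

(** Times are rounded down to a grid of mesh 1/(n+1).  Negative times are
    clipped to 0 because paths are only controlled on [0, +oo[. *)
Definition grid_point (n : nat) (s : R) : R :=
  (Num.truncn (n.+1%:R * Num.max 0 s))%:R / n.+1%:R.

Lemma grid_point_ge0 n s : 0 <= grid_point n s.
Proof. by rewrite divr_ge0. Qed.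

Lemma cvg_grid_point s : grid_point n s @[n --> \oo] --> Num.max 0 s.
Proof.
set x := Num.max 0 s; have x0 : 0 <= x by rewrite le_max lexx.
apply: (@squeeze_cvgr _ _ _ _ (fun n => x - n.+1%:R^-1) (fun=> x)); last first.
- exact: cvg_cst.
- rewrite -[X in _ --> X]subr0; apply: cvgB; first exact: cvg_cst.
  exact: cvg_harmonic.
- apply: nearW => n; rewrite /grid_point -/x.
  have n0 : 0 < n.+1%:R :> R by rewrite ltr0n.
  have /andP[h1 h2] := truncn_itv (mulr_ge0 (ltW n0) x0).
  rewrite ler_pdivlMr// ler_pdivrMr// mulrBl mulVf ?gt_eqF// [x * _]mulrC h1 andbT.
  by rewrite lerBlDr natr1 ltW.
Qed.

Lemma measurable_fun_grid X n : (forall t, 0 <= t -> measurable_fun setT (X t)) ->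
  measurable_fun setT (fun z : measurableTypeR R * T => X (grid_point n z.1) z.2).
Proof.
move=> mX _ A mA; rewrite setTI.
pose g (s : measurableTypeR R) : R := n.+1%:R * Num.max 0 s.
have mg : measurable_fun setT g.
  by apply: measurable_funM => //; apply: measurable_maxr.
rewrite (_ : _ @^-1` _ = \bigcup_m
    ((g @^-1` `[m%:R, m.+1%:R[%classic) `*` (X (m%:R / n.+1%:R) @^-1` A))).
  apply: bigcup_measurable => m _; apply: measurableX.
    by rewrite -[_ @^-1` _]setTI; apply: mg => //; exact: measurable_itv.
  by rewrite -[_ @^-1` _]setTI; apply: mX => //; rewrite divr_ge0.
have g0 s : 0 <= g s by rewrite mulr_ge0// le_max lexx.
apply/seteqP; split => [[s w]/= As|[s w] [m _ [/= gm Am]]].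
  exists (Num.truncn (g s)) => //; split => //=.
  by rewrite in_itv/=; exact: truncn_itv.
by rewrite /grid_point; move: gm; rewrite in_itv/= => /truncn_def ->.
Qed.

(** A process with continuous paths is jointly measurable, as the pointwise
    limit of its piecewise constant approximations. *)
Lemma measurable_fun_process X :
  (forall t, 0 <= t -> measurable_fun setT (X t)) ->
  (forall w, {within `[0, +oo[, continuous (fun t => X t w)}) ->
  measurable_fun setT (fun z : measurableTypeR R * T => X (Num.max 0 z.1) z.2).
Proof.
move=> mX cX; apply: (@measurable_fun_cvg _ _ _ _
  (fun n (z : measurableTypeR R * T) => X (grid_point n z.1) z.2)).
  by move=> n; exact: measurable_fun_grid.
move=> [s w] _ /=.
have x0 : `[0, +oo[%classic (Num.max 0 s) by rewrite /= in_itv/= le_max lexx.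
have /subspace_continuousP/(_ _ x0) cXs := cX w.
have cg : grid_point n s @[n --> \oo] --> within `[0, +oo[ (nbhs (Num.max 0 s)).
  move=> U nU.
  have : \forall n \near \oo, `[0, +oo[%classic (grid_point n s) -> U (grid_point n s).
    exact: (@cvg_grid_point s _ nU).
  apply: filterS => n /=; apply.
  by rewrite in_itv/= andbT; exact: grid_point_ge0.
exact: (cvg_comp _ _ cg cXs).
Qed.

End joint_measurability.

Section majorant_expectation.
Context d (T : measurableType d) (R : realType) (P : probability T R).
Local Notation mu := (@lebesgue_measure R).
Variables (X : R -> T -> R).
Hypotheses (mX : forall t, 0 <= t -> measurable_fun setT (X t))
  (cX : forall w, {within `[0, +oo[, continuous (fun t => X t w)}).
Variables (lam a t : R) (n : nat) (Y : T -> R).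
Hypotheses (lam0 : 0 < lam) (a0 : 0 <= a) (at_ : a <= t)
  (mY : measurable_fun setT Y).
Local Open Scope ereal_scope.

Let h (z : measurableTypeR R * T) : \bar R :=
  (\1_(`[a, t]%classic : set (measurableTypeR R)) z.1 *
   (ou_kernel lam t z.1 * `|X t z.2 - X (Num.max 0 z.1) z.2| ^+ n))%:E.

Let h0 z : 0 <= h z.
Proof.
by rewrite lee_fin mulr_ge0// mulr_ge0 ?exprn_ge0// ou_kernel_ge0// ltW.
Qed.

Let t0 : (0 <= t)%R := le_trans a0 at_.

Let mh : measurable_fun setT h.
Proof.
apply/measurable_EFinP; apply: measurable_funM.
  by apply: measurableT_comp => //; exact: measurable_indic.
apply: measurable_funM.
  apply: (measurableT_comp (f := ou_kernel lam t : measurableTypeR R -> R)) => //.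
  by apply: continuous_measurable_fun; exact: continuous_ou_kernel.
apply: measurable_funX; apply: measurableT_comp => //; apply: measurable_funB.
  by apply: measurableT_comp => //; exact: mX.
exact: measurable_fun_process.
Qed.

Let integral_h w :
  \int[mu]_(s in `[a, t]) (ou_kernel lam t s * `|X t w - X s w| ^+ n)%:E =
  \int[mu]_s h (s, w).
Proof.
rewrite integral_mkcond; apply: eq_integral => s _; rewrite patchE /h/= indicE.
case: ifPn => [|_]; last by rewrite mul0r.
rewrite inE/= in_itv/= => /andP[as_ _]; rewrite mul1r max_r//.
exact: le_trans as_.
Qed.

Lemma measurable_ou_majorant :
  measurable_fun setT (fun w => ou_majorant lam (X ^~ w) n a t (Y w)).
Proof.
rewrite /ou_majorant; apply: emeasurable_funD.
  apply/measurable_EFinP; apply: measurable_funM => //.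
  apply: measurable_funX; apply: measurableT_comp => //.
  by apply: measurable_funB => //; exact: mX.
under eq_fun do rewrite integral_h.
exact: (measurable_fun_fubini_tonelli_G (m1 := mu) h mh h0).
Qed.

Lemma ou_majorant_ge0 w : 0 <= ou_majorant lam (X ^~ w) n a t (Y w).
Proof.
rewrite adde_ge0//.
apply: integral_ge0 => s _; rewrite lee_fin mulr_ge0 ?exprn_ge0//.
by rewrite ou_kernel_ge0// ltW.
Qed.

(** Tonelli's theorem, applied to the jointly measurable integrand h. *)
Lemma integral_ou_majorant :
  \int[P]_w ou_majorant lam (X ^~ w) n a t (Y w) =
  (expR (- (lam * (t - a))))%:E * \int[P]_w (`|X t w - Y w| ^+ n)%:E +
  \int[mu]_(s in `[a, t]) ((ou_kernel lam t s)%:E *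
     \int[P]_w (`|X t w - X s w| ^+ n)%:E).
Proof.
have mN (s : R) : (0 <= s)%R -> measurable_fun setT (fun w => (`|X t w - X s w| ^+ n)%:E).
  move=> s0; apply/measurable_EFinP; apply: measurable_funX.
  by apply: measurableT_comp => //; apply: measurable_funB; exact: mX.
have mNY : measurable_fun setT (fun w => (`|X t w - Y w| ^+ n)%:E).
  apply/measurable_EFinP; apply: measurable_funX.
  by apply: measurableT_comp => //; apply: measurable_funB => //; exact: mX.
rewrite /ou_majorant ge0_integralD//; last 3 first.
- under eq_fun do rewrite EFinM; exact: emeasurable_funM.
- move=> w _; apply: integral_ge0 => s _; rewrite lee_fin mulr_ge0 ?exprn_ge0//.
  by rewrite ou_kernel_ge0// ltW.
- under eq_fun do rewrite integral_h.
  exact: (measurable_fun_fubini_tonelli_G (m1 := mu) h mh h0).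
congr (_ + _).
  under eq_integral do rewrite EFinM.
  by rewrite ge0_integralZl// ?lee_fin ?expR_ge0// => w _; rewrite lee_fin exprn_ge0.
under eq_integral do rewrite integral_h.
rewrite -(fubini_tonelli (m1 := mu) (m2 := P) h mh h0) [RHS]integral_mkcond.
apply: eq_integral => s _; rewrite patchE /h/= indicE.
case: ifPn => [|_]; last first.
  by under eq_integral do rewrite mul0r; rewrite integral0.
rewrite inE/= in_itv/= => /andP[as_ _].
have s0 := le_trans a0 as_.
under eq_integral do rewrite mul1r max_r// EFinM.
rewrite ge0_integralZl//; first exact: mN.
by rewrite lee_fin ou_kernel_ge0// ltW.
Qed.

End majorant_expectation.

Section monotone_integral.
Context d (T : measurableType d) (R : realType).
Variable mu : {measure set T -> \bar R}.
Local Open Scope ereal_scope.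
Import HBNNSimple.

(** The integral of a nonnegative function is a supremum over the simple
    functions below it.  This covers the norm of the process, a function of the
    sample point that is not known to be measurable. *)
Lemma le_integral_nonmeasurable (D : set T) (f g : T -> \bar R) :
  (forall x, D x -> 0 <= f x) -> (forall x, D x -> f x <= g x) ->
  \int[mu]_(x in D) f x <= \int[mu]_(x in D) g x.
Proof.
move=> f0 fg; rewrite integral_mkcond [leRHS]integral_mkcond.
have f0' x : 0 <= (f \_ D) x by exact: erestrict_ge0.
have fg' x : (f \_ D) x <= (g \_ D) x by exact: lee_restrict.
rewrite !ge0_integralTE//; last by move=> x; exact: le_trans (fg' x).
apply: le_ereal_sup => _ [h hf <-]; exists h => // x.
exact: le_trans (hf x) (fg' x).
Qed.

(** Where h is infinite so is g + eps h, hence f <= g + eps h everywhere for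
    every eps > 0, and the integral of eps h is as small as desired. *)
Lemma le_integral_finite_guard (f g h : T -> \bar R) :
  measurable_fun setT g -> measurable_fun setT h ->
  (forall x, 0 <= f x) -> (forall x, 0 <= g x) -> (forall x, 0 <= h x) ->
  \int[mu]_x h x < +oo -> (forall x, h x < +oo -> f x <= g x) ->
  \int[mu]_x f x <= \int[mu]_x g x.
Proof.
move=> mg mh f0 g0 h0 hoo fg; apply/lee_addgt0Pr => e e0.
have I0 : 0 <= \int[mu]_x h x by exact: integral_ge0.
pose I := fine (\int[mu]_x h x).
have IE : \int[mu]_x h x = I%:E by rewrite fineK// ge0_fin_numE.
have I1 : (0 < I + 1)%R by rewrite ltr_wpDl// -lee_fin -IE.
pose eps := (e / (I + 1))%R.
have eps0 : (0 < eps)%R by rewrite divr_gt0.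
have eh0 x : 0 <= eps%:E * h x by rewrite mule_ge0// lee_fin ltW.
apply: (@le_trans _ _ (\int[mu]_x (g x + eps%:E * h x))).
  apply: le_integral_nonmeasurable => // x _.
  have [hx|hx] := ltP (h x) +oo; first by rewrite (le_trans (fg x hx))// leeDl.
  have -> : h x = +oo by apply/eqP; rewrite eq_le hx leey.
  by rewrite gt0_muley ?lte_fin// addey ?leey// -ltNye (lt_le_trans _ (g0 x)).
rewrite ge0_integralD//; last exact: emeasurable_funM.
rewrite leeD2l// ge0_integralZl//; last by rewrite lee_fin ltW.
rewrite IE -EFinM lee_fin /eps -mulrA ger_pMr// mulrC ler_pdivrMr// mul1r.
by rewrite lerDl.
Qed.

End monotone_integral.

Section fBm_majorant.
Context {R : realType}.
Local Notation mu := (@lebesgue_measure R).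
Local Open Scope ereal_scope.

Lemma normr_exprM (x : R) n : (`|x| ^+ (2 * n) = x ^+ (2 * n))%R.
Proof. by rewrite !exprM real_normK// num_real. Qed.

(** For a time lag u in an interval of length v: the factor u^r is bounded by
    the length of the interval, the factor u^q is absorbed by the exponential
    and becomes a power of 1/lam. *)
Lemma split_powR_le (lam u v r q D : R) : (0 < lam)%R -> (0 <= u <= v)%R ->
  (0 <= r)%R -> (0 <= q)%R -> (0 < r + q)%R ->
  (forall x, 0 <= x -> x `^ q <= D * expR (x / 2))%R ->
  (u `^ (r + q) <= D * v `^ r * lam `^ (- q) * expR (lam / 2 * u))%R.
Proof.
move=> lam0 /andP[u0 uv] r0 q0 rq hD.
rewrite powRD; last by rewrite gt_eqF.
have -> : (u `^ q = lam `^ (- q) * (lam * u) `^ q)%R.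
  rewrite powRM// ?(ltW lam0)// mulrA -powRD ?(gt_eqF lam0) ?implybT//.
  by rewrite addNr powRr0 mul1r.
have := hD (lam * u)%R (mulr_ge0 (ltW lam0) u0) => h.
have -> : (D * v `^ r * lam `^ (- q) * expR (lam / 2 * u) =
  v `^ r * (lam `^ (- q) * (D * expR (lam * u / 2))))%R.
  by rewrite [(lam / 2 * u)%R]mulrAC; ring.
apply: ler_pM; rewrite ?mulr_ge0 ?powR_ge0//.
  by rewrite ge0_ler_powR// nnegrE// (le_trans u0 uv).
by rewrite ler_wpM2l// powR_ge0.
Qed.

(** The exponent 2Hp of the moments is shared between r, the regularity in
    time, and q, the decay in lam.  The exponential of [split_powR_le] uses
    half of the rate of the kernel; the kernel of rate lam/2 that is left, with
    the corresponding point mass, still has total mass at most 2. *)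
Lemma ou_majorant_moment_le (p : nat) (H r q : R) : (0 < H)%R ->
  (0 <= r)%R -> (0 <= q)%R -> (0 < r + q)%R -> (r + q = 2 * H * p%:R)%R ->
  exists2 C : R, (0 < C)%R &
  forall d (T : measurableType d) (P : probability T R) X, is_fBm P H X ->
  forall lam, (0 < lam)%R ->
  (forall t, (0 <= t)%R ->
    \int[P]_w ou_majorant lam (X ^~ w) (2 * p) 0 t 0 <=
    (C * t `^ r * lam `^ (- q))%:E) /\
  (forall a t, (0 <= a <= t)%R ->
    \int[P]_w ou_majorant lam (X ^~ w) (2 * p) a t (X a w) <=
    (C * (t - a) `^ r * lam `^ (- q))%:E).
Proof.
move=> H0 r0 q0 rq rqE.
have [C C0 hC] := @is_fBm_moment_le R p H H0.
have [D D0 hD] := powR_le_expR q0.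
exists (2 * C * D)%R; first by rewrite !mulr_gt0.
move=> d T P X fX lam lam0.
have [hC1 hC2] := hC _ _ _ _ fX.
have mX t : (0 <= t)%R -> measurable_fun setT (X t).
  by move=> t0; exact: is_fBm_measurable fX _ t0.
have cX w : {within `[0%R, +oo[, continuous (fun t => X t w)} by case: fX.
have core a t (Y : T -> R) : (0 <= a <= t)%R -> measurable_fun setT Y ->
    \int[P]_w (`|X t w - Y w| ^+ (2 * p))%:E <= (C * (t - a) `^ (r + q))%:E ->
    \int[P]_w ou_majorant lam (X ^~ w) (2 * p) a t (Y w) <=
    (2 * C * D * (t - a) `^ r * lam `^ (- q))%:E.
  move=> /andP[a0 at_] mY hY.
  have t0 := le_trans a0 at_.
  rewrite integral_ou_majorant//.
  pose K := (C * (D * (t - a) `^ r * lam `^ (- q)))%R.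
  have K0 : (0 <= K)%R.
    by rewrite mulr_ge0 ?(ltW C0)// !mulr_ge0 ?powR_ge0// ltW.
  pose e := expR (- (lam / 2 * (t - a))).
  have e0 : (0 <= e)%R by exact: expR_ge0.
  have bound u : (0 <= u <= t - a)%R ->
      (C * u `^ (r + q) <= K * expR (lam / 2 * u))%R.
    move=> u0; rewrite /K -mulrA ler_wpM2l ?(ltW C0)//.
    exact: split_powR_le.
  apply: (@le_trans _ _ ((e * K)%:E + (2 * K * (1 - e))%:E)); last first.
    rewrite -EFinD lee_fin.
    have -> : (2 * C * D * (t - a) `^ r * lam `^ (- q) = 2 * K)%R.
      by rewrite /K; ring.
    have := mulr_ge0 e0 K0; lra.
  apply: leeD.
    have -> : (e * K = expR (- (lam * (t - a))) * (K * expR (lam / 2 * (t - a))))%R.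
      by rewrite [RHS]mulrCA -expRD [LHS]mulrC; congr (_ * expR _)%R; field.
    rewrite EFinM lee_wpmul2l ?lee_fin ?expR_ge0//.
    apply: (le_trans hY); rewrite lee_fin; apply: bound.
    by rewrite subr_ge0 at_ lexx.
  have lam20 : (0 <= lam / 2)%R by rewrite divr_ge0// ltW.
  have -> : (2 * K * (1 - e))%:E =
      \int[mu]_(s in `[a, t]) ((2 * K)%:E * (ou_kernel (lam / 2) t s)%:E).
    rewrite ge0_integralZl//.
    - by rewrite integral_ou_kernel.
    - apply/measurable_EFinP/measurable_funTS.
      by apply: continuous_measurable_fun; exact: continuous_ou_kernel.
    - by move=> s _; rewrite lee_fin ou_kernel_ge0.
    - by rewrite lee_fin mulr_ge0.
  apply: le_integral_nonmeasurable.
    move=> s _; rewrite mule_ge0 ?lee_fin ?ou_kernel_ge0 ?(ltW lam0)//.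
    by apply: integral_ge0 => w _; rewrite lee_fin exprn_ge0.
  move=> s /=; rewrite in_itv/= => /andP[as_ st].
  have s0 := le_trans a0 as_.
  apply: (@le_trans _ _ ((ou_kernel lam t s)%:E * (K * expR (lam / 2 * (t - s)))%:E)).
    rewrite lee_wpmul2l ?lee_fin ?ou_kernel_ge0 ?(ltW lam0)//.
    under eq_integral do rewrite normr_exprM.
    apply: le_trans (hC2 _ _ _) _; first by rewrite s0.
    by rewrite -rqE lee_fin bound// subr_ge0 st lerD2l lerN2.
  rewrite -!EFinM lee_fin le_eqVlt; apply/orP; left; apply/eqP.
  rewrite /ou_kernel.
  have -> : (- (lam / 2 * (t - s)) = - (lam * (t - s)) + lam / 2 * (t - s))%R by field.
  by rewrite expRD; field.
split => [t t0|a t /andP[a0 at_]].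
  have := core 0%R t (fun=> 0%R); rewrite subr0; apply => //; first by rewrite lexx.
  by under eq_integral do rewrite subr0 normr_exprM; rewrite rqE; exact: hC1.
apply: core; [by rewrite a0|exact: mX|].
under eq_integral do rewrite normr_exprM; rewrite rqE.
by apply: hC2; rewrite a0.
Qed.

End fBm_majorant.

Section coordinate_increments.
Context {R : realType}.
Variables (lam : R) (b : R -> R) (p : nat).
Hypotheses (lam0 : 0 < lam) (cb : {within `[0, +oo[, continuous b}) (p0 : (0 < p)%N).
Local Open Scope ereal_scope.

Lemma ou_incr_even_le_majorant a t y : (0 <= a <= t)%R ->
  (ou_incr lam b a t y ^+ (2 * p))%:E <= ou_majorant lam b (2 * p) a t y.
Proof.
move=> at_; rewrite -normr_exprM; case: p p0 => // q _.
by rewrite mulnS; exact: ou_incr_le_majorant.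
Qed.

Lemma ou_int_even_le_majorant t : (0 <= t)%R ->
  (ou_int lam b t ^+ (2 * p))%:E <= ou_majorant lam b (2 * p) 0 t 0.
Proof.
move=> t0; rewrite ou_int_incr0//; apply: ou_incr_even_le_majorant.
by rewrite lexx.
Qed.

(** Majorant of the (2p)-th power of the increment given by [ou_intB].  The
    constant comes from (x+y)^(2p) <= 4^p (x^(2p) + y^(2p)), and the power s
    from [sub1expRN_exprn_le] applied to the damping factor. *)
Definition ou_incr_majorant (s t1 t2 : R) : \bar R :=
  (4 ^+ p)%:E * (((lam * (t2 - t1)) `^ s)%:E * ou_majorant lam b (2 * p) 0 t1 0 +
    ou_majorant lam b (2 * p) t1 t2 (b t1)).

Lemma ou_intB_le_majorant (s t1 t2 : R) : (0 <= s <= (2 * p)%:R)%R ->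
  (0 <= t1 <= t2)%R ->
  ((ou_int lam b t2 - ou_int lam b t1) ^+ (2 * p))%:E <= ou_incr_majorant s t1 t2.
Proof.
move=> s0 /[dup] t12 /andP[t10 t12']; rewrite ou_intB//.
set e := expR _; set z := ou_int _ _ _; set i := ou_incr _ _ _ _ _.
have le4 (x y : R) : ((x + y) ^+ (2 * p) <= 4 ^+ p * (x ^+ (2 * p) + y ^+ (2 * p)))%R.
  rewrite !exprM.
  set u := (x ^+ 2)%R; set v := (y ^+ 2)%R.
  have u0 : (0 <= u)%R by exact: sqr_ge0.
  have v0 : (0 <= v)%R by exact: sqr_ge0.
  have m0 : (0 <= Num.max u v)%R by rewrite le_max u0.
  apply: (@le_trans _ _ ((4 * Num.max u v) ^+ p)%R).
    rewrite lerXn2r ?nnegrE ?sqr_ge0 ?mulr_ge0//.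
    apply: (@le_trans _ _ (2 * u + 2 * v)%R).
      rewrite -subr_ge0 (_ : _ - _ = (x - y) ^+ 2)%R ?sqr_ge0//.
      by rewrite /u /v; ring.
    have : (u <= Num.max u v)%R by rewrite le_max lexx.
    have : (v <= Num.max u v)%R by rewrite le_max lexx orbT.
    lra.
  rewrite exprMn ler_wpM2l ?exprn_ge0//.
  by rewrite /Num.max; case: ifP => _; rewrite ?lerDl ?lerDr exprn_ge0.
apply: (@le_trans _ _ ((4 ^+ p)%:E * ((((e - 1) * z) ^+ (2 * p))%:E + (i ^+ (2 * p))%:E))).
  by rewrite -EFinD -EFinM lee_fin le4.
rewrite /ou_incr_majorant lee_wpmul2l ?lee_fin ?exprn_ge0// leeD//; last first.
  exact: ou_incr_even_le_majorant.
rewrite exprMn EFinM lee_pmul ?lee_fin//.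
- by rewrite exprM exprn_ge0// sqr_ge0.
- by rewrite exprM exprn_ge0// sqr_ge0.
- rewrite -normr_exprM distrC normr_exprM; apply: sub1expRN_exprn_le => //.
  by rewrite mulr_ge0 ?(ltW lam0)// subr_ge0.
- exact: ou_int_even_le_majorant.
Qed.

End coordinate_increments.

Section increment_expectation.
Context {R : realType}.
Local Open Scope ereal_scope.

Lemma ou_majorant0_moment_le (p : nat) (H : R) : (0 < H)%R -> (0 < p)%N ->
  exists2 C : R, (0 < C)%R &
  forall d (T : measurableType d) (P : probability T R) X, is_fBm P H X ->
  forall lam t, (0 < lam)%R -> (0 <= t)%R ->
    \int[P]_w ou_majorant lam (X ^~ w) (2 * p) 0 t 0 <=
    (C * lam `^ (- (2 * H * p%:R)))%:E.
Proof.
move=> H0 p0; have hp0 : (0 < 2 * H * p%:R)%R by rewrite !mulr_gt0// ltr0n.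
have [|C C0 hC] := @ou_majorant_moment_le R p H 0 _ H0 (lexx _) (ltW hp0) _ (add0r _).
  by rewrite add0r.
exists C => // d T P X fX lam t lam0 t0.
by have [/(_ t t0)] := hC _ _ _ _ fX lam lam0; rewrite powRr0 mulr1.
Qed.

Section measurability.
Context d (T : measurableType d) (P : probability T R) (H : R) (X : R -> T -> R).
Hypothesis fX : is_fBm P H X.
Variables (lam : R) (p : nat).
Hypothesis lam0 : (0 < lam)%R.

Let mX t : (0 <= t)%R -> measurable_fun setT (X t).
Proof. by move=> t0; exact: is_fBm_measurable fX _ t0. Qed.

Let cX w : {within `[0%R, +oo[, continuous (fun t => X t w)}.
Proof. by case: fX. Qed.

Lemma measurable_fBm_majorant0 t : (0 <= t)%R ->
  measurable_fun setT (fun w => ou_majorant lam (X ^~ w) (2 * p) 0 t 0).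
Proof. by move=> t0; apply: (measurable_ou_majorant mX cX). Qed.

Lemma measurable_fBm_majorant a t : (0 <= a <= t)%R ->
  measurable_fun setT (fun w => ou_majorant lam (X ^~ w) (2 * p) a t (X a w)).
Proof.
by move=> /andP[a0 at_]; apply: (measurable_ou_majorant mX cX) => //; exact: mX.
Qed.

Lemma fBm_majorant0_ge0 t w : 0 <= ou_majorant lam (X ^~ w) (2 * p) 0 t 0.
Proof. exact: (ou_majorant_ge0 X). Qed.

Lemma ou_incr_majorant_ge0 s t1 t2 w : 0 <= ou_incr_majorant lam (X ^~ w) p s t1 t2.
Proof.
rewrite mule_ge0 ?lee_fin ?exprn_ge0// adde_ge0//; last exact: (ou_majorant_ge0 X).
by rewrite mule_ge0 ?lee_fin ?powR_ge0//; exact: fBm_majorant0_ge0.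
Qed.

Lemma measurable_ou_incr_majorant s t1 t2 : (0 <= t1 <= t2)%R ->
  measurable_fun setT (fun w => ou_incr_majorant lam (X ^~ w) p s t1 t2).
Proof.
move=> /[dup] t12 /andP[t10 _]; apply: emeasurable_funM => //.
apply: emeasurable_funD; last exact: measurable_fBm_majorant.
by apply: emeasurable_funM => //; exact: measurable_fBm_majorant0.
Qed.

Lemma integral_ou_incr_majorant s t1 t2 : (0 <= t1 <= t2)%R ->
  \int[P]_w ou_incr_majorant lam (X ^~ w) p s t1 t2 =
  (4 ^+ p)%:E * (((lam * (t2 - t1)) `^ s)%:E *
      \int[P]_w ou_majorant lam (X ^~ w) (2 * p) 0 t1 0 +
    \int[P]_w ou_majorant lam (X ^~ w) (2 * p) t1 t2 (X t1 w)).
Proof.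
move=> /[dup] t12 /andP[t10 _].
have m1 := measurable_fBm_majorant0 t10; have m2 := measurable_fBm_majorant t12.
have p1 w : 0 <= ((lam * (t2 - t1)) `^ s)%:E * ou_majorant lam (X ^~ w) (2 * p) 0 t1 0.
  by rewrite mule_ge0 ?lee_fin ?powR_ge0//; exact: fBm_majorant0_ge0.
have p2 w : 0 <= ou_majorant lam (X ^~ w) (2 * p) t1 t2 (X t1 w).
  exact: (ou_majorant_ge0 X).
rewrite /ou_incr_majorant ge0_integralZl//.
- rewrite ge0_integralD//; last exact: emeasurable_funM.
  rewrite ge0_integralZl ?lee_fin ?powR_ge0// => w _.
  exact: fBm_majorant0_ge0.
- by apply: emeasurable_funD => //; exact: emeasurable_funM.
- by move=> w _; rewrite adde_ge0.
Qed.

End measurability.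

(** The damped term uses [ou_majorant_moment_le] with no regularity in time,
    since its factor (lam (t2-t1))^s already provides it; the other term uses
    the split with r = s.  Both give the same power of lam. *)
Lemma ou_incr_majorant_moment_le (p : nat) (H s : R) :
  (0 < H)%R -> (0 < p)%N -> (0 < s < 2 * H * p%:R)%R ->
  exists2 C : R, (0 < C)%R &
  forall d (T : measurableType d) (P : probability T R) X, is_fBm P H X ->
  forall lam t1 t2, (0 < lam)%R -> (0 <= t1 <= t2)%R ->
    \int[P]_w ou_incr_majorant lam (X ^~ w) p s t1 t2 <=
    (C * (t2 - t1) `^ s * lam `^ (- (2 * H * p%:R - s)))%:E.
Proof.
move=> H0 p0 /andP[s0 sH].
have [C1 C10 hC1] := ou_majorant0_moment_le H0 p0.
have r0 : (0 < 2 * H * p%:R - s)%R by rewrite subr_gt0.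
have rE : (s + (2 * H * p%:R - s) = 2 * H * p%:R)%R by ring.
have [C2 C20 hC2] := ou_majorant_moment_le H0 (ltW s0) (ltW r0) (addr_gt0 s0 r0) rE.
exists (4 ^+ p * (C1 + C2))%R; first by rewrite mulr_gt0 ?exprn_gt0// addr_gt0.
move=> d T P X fX lam t1 t2 lam0 /[dup] t12 /andP[t10 t12'].
have dt0 : (0 <= t2 - t1)%R by rewrite subr_ge0.
rewrite (integral_ou_incr_majorant fX _ lam0)//.
apply: (@le_trans _ _ ((4 ^+ p)%:E * (((lam * (t2 - t1)) `^ s)%:E *
    (C1 * lam `^ (- (2 * H * p%:R)))%:E +
    (C2 * (t2 - t1) `^ s * lam `^ (- (2 * H * p%:R - s)))%:E))).
  rewrite lee_wpmul2l ?lee_fin ?exprn_ge0// leeD//.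
    by rewrite lee_wpmul2l ?lee_fin ?powR_ge0//; exact: hC1 fX _ _ lam0 t10.
  by have [_] := hC2 _ _ _ _ fX _ lam0; exact.
rewrite -(EFinM _ (C1 * _)) -EFinD -EFinM lee_fin le_eqVlt.
apply/orP; left; apply/eqP; rewrite powRM ?(ltW lam0)//.
have -> : (- (2 * H * p%:R - s) = s + - (2 * H * p%:R))%R by ring.
by rewrite powRD ?(gt_eqF lam0) ?implybT//; ring.
Qed.

End increment_expectation.

(** * Summation over the coordinates *)

Section weighted_series.
Context {R : realType}.
Local Open Scope ereal_scope.

Lemma exprS_sum_le_eseries (q n : nat) (x w : nat -> R) (W : R) (G : nat -> \bar R) :
  (forall k, 0 <= x k)%R -> (forall k, 0 < w k)%R ->
  (forall m, \sum_(k < m) w k <= W)%R ->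
  (forall k, (x k ^+ q.+1)%:E <= G k) ->
  ((\sum_(k < n) x k)%R ^+ q.+1)%:E <=
  (W ^+ q)%:E * \sum_(k <oo) ((w k ^+ q)^-1)%:E * G k.
Proof.
move=> x0 w0 wW xG.
have G0 k : 0 <= G k by apply: le_trans (xG k); rewrite lee_fin exprn_ge0.
have wq0 k : (0 <= (w k ^+ q)^-1)%R by rewrite invr_ge0 exprn_ge0// ltW.
have s0 : (0 <= \sum_(k < n) w k)%R by apply: sumr_ge0 => k _; exact: ltW.
apply: (@le_trans _ _ ((W ^+ q)%:E * (\sum_(k < n) x k ^+ q.+1 / w k ^+ q)%R%:E)).
  rewrite -EFinM lee_fin; apply: le_trans (exprS_sum_le_weighted n q x0 w0) _.
  rewrite ler_wpM2r//.
    by apply: sumr_ge0 => k _; rewrite mulr_ge0// exprn_ge0.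
  by rewrite lerXn2r ?nnegrE// (le_trans s0).
rewrite lee_wpmul2l ?lee_fin ?exprn_ge0 ?(le_trans s0)//.
apply: (@le_trans _ _ (\sum_(0 <= k < n) ((w k ^+ q)^-1)%:E * G k)).
  rewrite big_mkord -sumEFin; apply: lee_sum => k _.
  by rewrite mulrC EFinM lee_wpmul2l// lee_fin.
by apply: nneseries_lim_ge => k _ _; rewrite mule_ge0// lee_fin.
Qed.

End weighted_series.

Section weighted_series_expectation.
Context d (T : measurableType d) (R : realType) (P : {measure set T -> \bar R}).
Local Open Scope ereal_scope.

(** The weights are tuned so that the k-th term contributes
    A w_k^(q+1) / w_k^q = A w_k, the general term of a convergent series. *)
Lemma integral_eseries_le (q : nat) (w : nat -> R) (W A : R) (G : nat -> T -> \bar R) :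
  (0 <= A)%R -> (forall k, 0 < w k)%R -> (forall m, \sum_(k < m) w k <= W)%R ->
  (forall k, measurable_fun setT (G k)) -> (forall k x, 0 <= G k x) ->
  (forall k, \int[P]_x G k x <= (A * w k ^+ q.+1)%:E) ->
  \int[P]_x ((W ^+ q)%:E * \sum_(k <oo) ((w k ^+ q)^-1)%:E * G k x) <=
  (W ^+ q * A * W)%:E.
Proof.
move=> A0 w0 wW mG G0 GA.
have wq0 k : (0 < w k ^+ q)%R by rewrite exprn_gt0.
have W0 : (0 <= W)%R by have := wW 0%N; rewrite big_ord0.
have mwG k : measurable_fun setT (fun x => ((w k ^+ q)^-1)%:E * G k x).
  exact: emeasurable_funM.
have wG0 k x : 0 <= ((w k ^+ q)^-1)%:E * G k x.
  by rewrite mule_ge0// lee_fin invr_ge0 ltW.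
rewrite ge0_integralZl//; last 3 first.
- exact: ge0_emeasurable_sum.
- by move=> x _; exact: nneseries_ge0.
- by rewrite lee_fin exprn_ge0.
rewrite -mulrA EFinM lee_wpmul2l ?lee_fin ?exprn_ge0//.
rewrite integral_nneseries//.
apply: (@le_trans _ _ (\sum_(k <oo) (A * w k)%:E)).
  apply: lee_nneseries => k _; first by move=> _; exact: integral_ge0.
  rewrite ge0_integralZl//; last by rewrite lee_fin invr_ge0 ltW.
  apply: le_trans (lee_wpmul2l _ (GA k)) _; first by rewrite lee_fin invr_ge0 ltW.
  by rewrite -EFinM lee_fin mulrCA exprSr mulKf// gt_eqF.
apply: lime_le; first by apply: is_cvg_nneseries => k _ _; rewrite lee_fin mulr_ge0// ltW.
apply: nearW => n; rewrite sumEFin lee_fin big_mkord -mulr_sumr.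
by rewrite ler_wpM2l.
Qed.

End weighted_series_expectation.

Section eigenvalue_weights.
Context {R : realType}.
Implicit Types sigma : R.

Lemma eigenval_ge1 k : 1 <= eigenval R k.
Proof.
rewrite /eigenval -[leLHS]mulr1 ler_pM// ?exprn_ege1//; first by rewrite ler1n.
by have := pi_ge2 R; lra.
Qed.

Lemma eigenval_gt0 k : 0 < eigenval R k.
Proof. exact: lt_le_trans ltr01 (eigenval_ge1 k). Qed.

Lemma sum_eigenval_powRN_le sigma (n : nat) : 2^-1 < sigma ->
  \sum_(k < n) eigenval R k `^ (- sigma) <= 1 + (2 * sigma - 1)^-1.
Proof.
move=> sg; have d0 : 0 < 2 * sigma - 1 by lra.
apply: le_trans (sum_powRN_le n d0); apply: ler_sum => k _.
have -> : - (1 + (2 * sigma - 1)) = 2%:R * - sigma :> R by ring.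
rewrite powRrM powR_mulrn// !powRN.
rewrite lef_pV2 ?posrE ?powR_gt0 ?exprn_gt0 ?eigenval_gt0//.
rewrite ge0_ler_powR ?nnegrE ?(ltW (eigenval_gt0 _))//; first by lra.
rewrite /eigenval ler_peMr// exprn_ege1//.
by have := pi_ge2 R; lra.
Qed.

Lemma le_1D_of_exprS_le (q : nat) (x b : R) : 0 <= x -> x ^+ q.+1 <= b -> x <= 1 + b.
Proof.
move=> x0 xb; have b0 : 0 <= b by apply: le_trans xb; exact: exprn_ge0.
have [x1|x1] := leP x 1; first by rewrite (le_trans x1)// lerDl.
have : x <= x ^+ q.+1 by rewrite ler_eXnr// ltW.
lra.
Qed.

End eigenvalue_weights.

Section fOU_path.
Context d (T : measurableType d) (R : realType).
Implicit Types (beta : nat -> R -> T -> R) (t : R) (w : T).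

Lemma fOU_coefE beta k t w :
  fOU_coef beta k t w = ou_int (eigenval R k) (beta k ^~ w) t.
Proof. exact: wiener_int_ou. Qed.

Lemma fOU_cvg beta t w B :
  (forall n, \sum_(k < n) fOU_coef beta k t w ^+ 2 <= B) ->
  (fun n => L2norm (eigen_sum (fun k => fOU_coef beta k t w) n - fOU beta t w))
    @ \oo --> 0.
Proof.
move=> h; have := @eigen_sum_cvg R (fun k => fOU_coef beta k t w) B h.
exact: xgetPex.
Qed.

Lemma fOU_incr_norm_le beta t1 t2 w B1 B2 (p : nat) (B : R) :
  (forall n, \sum_(k < n) fOU_coef beta k t1 w ^+ 2 <= B1) ->
  (forall n, \sum_(k < n) fOU_coef beta k t2 w ^+ 2 <= B2) ->
  (forall n, (\sum_(k < n) (fOU_coef beta k t2 w - fOU_coef beta k t1 w) ^+ 2) ^+ p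
    <= B) ->
  L2norm (fOU beta t2 w - fOU beta t1 w) ^+ (2 * p) <= B.
Proof.
move=> /fOU_cvg c1 /fOU_cvg c2 hB.
apply: (L2norm_cvg_limit_le c2 c1) => n.
by rewrite eigen_sumB exprM L2norm_eigen_sum.
Qed.

End fOU_path.

(** * Temporal regularity of the fractional Ornstein-Uhlenbeck process *)

Theorem proposition3p3 (R : realType) (p : nat) (H alpha : R)
    (hp : (1 <= p)%N)
    (hH : 4^-1 < H < 2^-1 \/ 2^-1 < H < 1)
    (halpha : 0 < alpha < 2 * H - 2^-1) :
  exists C : R, 0 < C /\
    forall (d : measure_display) (T : measurableType d) (P : probability T R)
      (beta : nat -> R -> T -> R),
      (forall k, is_fBm P H (beta k)) ->
      independent_processes P beta ->
      forall t1 t2 : R, 0 <= t1 -> t1 <= t2 ->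
        ('E_P[(fun w => L2norm (fOU beta t2 w - fOU beta t1 w) ^+ (2 * p))%R]
          <= (C * `|t2 - t1| `^ (p%:R * alpha))%R%:E)%E.
Proof.
case: p hp => // q _; set p' := q.+1.
move/andP: halpha => [al0 alH].
have [H14 H1] : 4^-1 < H /\ H < 1.
  by case: hH => /andP[h1 h2]; split => //; lra.
have H0 : 0 < H by lra.
pose s := p'%:R * alpha.
(* The rate of decay in lambda_k that is left once the exponent alpha is spent
   on the regularity in time; alpha < 2 H - 1/2 means 2 sigma > 1. *)
pose sigma := 2 * H - alpha.
have p'0 : 0 < p'%:R :> R by rewrite ltr0n.
have s0 : 0 < s by rewrite mulr_gt0.
have sg : 2^-1 < sigma by rewrite /sigma; lra.
have sg0 : 0 < sigma by lra.
have p'_gt0 : (0 < p')%N by [].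
have rE : p'%:R * sigma = 2 * H * p'%:R - s by rewrite /s /sigma; ring.
have [C1 C10 hC1] := ou_majorant0_moment_le H0 p'_gt0.
have sH : 0 < s < 2 * H * p'%:R.
  by rewrite s0/= -subr_gt0 -rE mulr_gt0.
have [C3 C30 hC3] := ou_incr_majorant_moment_le H0 p'_gt0 sH.
pose w k := eigenval R k `^ (- sigma).
have w0 k : 0 < w k by apply: powR_gt0; exact: eigenval_gt0.
pose W := 1 + (2 * sigma - 1)^-1.
have W0 : 0 < W by rewrite addr_gt0// invr_gt0; lra.
have wW m : \sum_(k < m) w k <= W by exact: sum_eigenval_powRN_le.
have wE k : w k ^+ p' = eigenval R k `^ (- (p'%:R * sigma)).
  by rewrite /w -powR_mulrn ?powR_ge0// -powRrM mulNr mulrC.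
exists (W ^+ q * C3 * W); split; first by rewrite mulr_gt0// mulr_gt0// exprn_gt0.
move=> d T P beta fB _ t1 t2 t10 t12.
have t20 := le_trans t10 t12.
have dt0 : 0 <= t2 - t1 by rewrite subr_ge0.
have lam0 := @eigenval_gt0 R.
have cX k v : {within `[0, +oo[, continuous (fun t => beta k t v)} by case: (fB k).
pose F t k v := ou_majorant (eigenval R k) (beta k ^~ v) (2 * p') 0 t 0.
pose G k v := ou_incr_majorant (eigenval R k) (beta k ^~ v) p' s t1 t2.
have mF t k : 0 <= t -> measurable_fun setT (F t k).
  exact: (measurable_fBm_majorant0 (fB k) p' (lam0 k)).
have F0 t k v : (0 <= F t k v)%E by exact: (fBm_majorant0_ge0 (beta k)).
have t12' : 0 <= t1 <= t2 by rewrite t10.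
have mG k : measurable_fun setT (G k).
  exact: (measurable_ou_incr_majorant (fB k) p' (lam0 k) s t12').
have G0 k v : (0 <= G k v)%E by exact: (ou_incr_majorant_ge0 (beta k)).
have EF t k : 0 <= t -> (\int[P]_v F t k v <= (C1 * w k ^+ p')%:E)%E.
  move=> t0; apply: le_trans (hC1 _ _ _ _ (fB k) _ _ (lam0 k) t0) _.
  rewrite lee_fin wE ler_wpM2l ?(ltW C10)//.
  by rewrite ler_powR ?eigenval_ge1// lerN2 rE; lra.
have EG k : (\int[P]_v G k v <= (C3 * (t2 - t1) `^ s * w k ^+ p')%:E)%E.
  by rewrite wE rE; exact: hC3 (fB k) _ _ _ (lam0 k) t12'.
(* Both series of Z(t1) and Z(t2) converge at v when S t1 v and S t2 v are
   finite, and D v then bounds the power of the norm of the increment. *)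
pose S t v := ((W ^+ q)%:E * \sum_(k <oo) ((w k ^+ q)^-1)%:E * F t k v)%E.
pose D v := ((W ^+ q)%:E * \sum_(k <oo) ((w k ^+ q)^-1)%:E * G k v)%E.
have ES t : 0 <= t -> (\int[P]_v S t v <= (W ^+ q * C1 * W)%:E)%E.
  move=> t0; apply: integral_eseries_le => //; first exact: ltW.
  - by move=> k; exact: mF.
  - by move=> k; exact: EF.
have ED : (\int[P]_v D v <= (W ^+ q * (C3 * (t2 - t1) `^ s) * W)%:E)%E.
  apply: integral_eseries_le => //.
  by rewrite mulr_ge0 ?powR_ge0// ltW.
have mS t : 0 <= t -> measurable_fun setT (S t).
  move=> t0; apply: emeasurable_funM => //; apply: ge0_emeasurable_sum => [k v _ _|k _].
    by rewrite mule_ge0 ?lee_fin ?invr_ge0 ?exprn_ge0 ?(ltW (w0 k)).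
  by apply: emeasurable_funM => //; exact: mF.
have mD : measurable_fun setT D.
  apply: emeasurable_funM => //; apply: ge0_emeasurable_sum => [k v _ _|k _].
    by rewrite mule_ge0 ?lee_fin ?invr_ge0 ?exprn_ge0 ?(ltW (w0 k)).
  exact: emeasurable_funM.
have S0 t v : (0 <= S t v)%E.
  rewrite mule_ge0 ?lee_fin ?exprn_ge0 ?(ltW W0)//.
  apply: nneseries_ge0 => k _ _.
  by rewrite mule_ge0 ?lee_fin ?invr_ge0 ?exprn_ge0 ?(ltW (w0 k)).
have D0 v : (0 <= D v)%E.
  rewrite mule_ge0 ?lee_fin ?exprn_ge0 ?(ltW W0)//.
  apply: nneseries_ge0 => k _ _.
  by rewrite mule_ge0 ?lee_fin ?invr_ge0 ?exprn_ge0 ?(ltW (w0 k)).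
have coef_le t v : 0 <= t -> (S t v < +oo)%E ->
    forall n, \sum_(k < n) fOU_coef beta k t v ^+ 2 <= 1 + fine (S t v).
  move=> t0 Soo n; apply: (@le_1D_of_exprS_le _ q); first by apply: sumr_ge0 => k _; exact: sqr_ge0.
  rewrite -lee_fin fineK ?ge0_fin_numE ?S0//.
  apply: (@exprS_sum_le_eseries _ q n (fun k => fOU_coef beta k t v ^+ 2)) => //.
    by move=> k; exact: sqr_ge0.
  by move=> k; rewrite -exprM fOU_coefE; exact: ou_int_even_le_majorant.
have s2p : 0 <= s <= (2 * p')%:R.
  by rewrite (ltW s0)/= /s mulnC natrM ler_wpM2l ?(ltW p'0)//; lra.
have pointwise v : (S t1 v < +oo)%E -> (S t2 v < +oo)%E ->
    ((L2norm (fOU beta t2 v - fOU beta t1 v) ^+ (2 * p'))%:E <= D v)%E.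
  move=> S1 S2; have [Doo|Doo] := ltP (D v) +oo%E; last by apply: le_trans Doo; rewrite leey.
  rewrite -[leRHS]fineK ?ge0_fin_numE// lee_fin.
  apply: (fOU_incr_norm_le (coef_le _ _ t10 S1) (coef_le _ _ t20 S2)) => n.
  rewrite -lee_fin fineK ?ge0_fin_numE//.
  apply: (@exprS_sum_le_eseries _ q n
    (fun k => (fOU_coef beta k t2 v - fOU_coef beta k t1 v) ^+ 2)) => //.
    by move=> k; exact: sqr_ge0.
  move=> k; rewrite -exprM !fOU_coefE; exact: ou_intB_le_majorant.
have SS1 v : (S t1 v + S t2 v < +oo)%E -> (S t1 v < +oo)%E.
  by apply: le_lt_trans; rewrite leeDl.
have SS2 v : (S t1 v + S t2 v < +oo)%E -> (S t2 v < +oo)%E.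
  by apply: le_lt_trans; rewrite leeDr.
rewrite unlock.
apply: (@le_trans _ _ (\int[P]_v D v)%E).
  apply: (@le_integral_finite_guard _ _ _ P _ D (fun v => S t1 v + S t2 v)%E) => //.
  - by apply: emeasurable_funD; exact: mS.
  - by move=> v; rewrite lee_fin exprn_ge0// L2norm_ge0.
  - by move=> v; rewrite adde_ge0.
  - rewrite ge0_integralD//; [|exact: mS|exact: mS].
    by rewrite lte_add_pinfty// (le_lt_trans (ES _ _)) ?ltry.
  - by move=> v SS; apply: pointwise; [exact: SS1|exact: SS2].
apply: (le_trans ED); rewrite lee_fin ger0_norm// -/s le_eqVlt.
by apply/orP; left; apply/eqP; ring.
Qed.
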